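(* Let $X\in\mathcal{RC}$. Then either $X$ is Corson compact or else $X$ contains a (topological) copy of the linearly ordered space $\omega_1+1$.
   Context: All spaces are completely regular Hausdorff; maps are continuous. A retraction is a map $f\colon X\to Y$ having a right inverse, i.e. a continuous $g\colon Y\to X$ with $fg=\mathrm{id}_Y$. An inverse sequence is an inverse system $\mathbb S=\langle X_\xi,p_\xi^\eta,\lambda\rangle$ indexed by an ordinal $\lambda$ (with $p_\xi^\eta\colon X_\eta\to X_\xi$ for $\xi\le\eta<\lambda$). It is continuous if for every limit ordinal $\delta<\lambda$ the space $X_\delta$ together with the maps $p_\xi^\delta$ ($\xi<\delta$) is the inverse limit of $\mathbb S\restriction\delta$. $\mathcal{RC}$ is the smallest class of compact spaces which contains all metrizable compact spaces and is closed under continuous (Hausdorff) images and under limits of continuous inverse sequences whose bonding maps are retractions. A compact space is Corson compact if for some $\kappa$ it embeds into the $\Sigma$-product $\Sigma(\kappa)=\{x\in[0,1]^\kappa: |\{\alpha<\kappa: x(\alpha)\neq 0\}|\le\aleph_0\}$. The ordinal $\omega_1+1$ carries its order topology. *)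

(* Defs.v *)
From mathcomp Require Import all_boot all_order all_algebra.
From mathcomp Require Import wochoice all_classical all_reals all_analysis.

Set Implicit Arguments.
Unset Strict Implicit.
Unset Printing Implicit Defensive.

Import Order.TTheory GRing.Theory Num.Theory.
Import numFieldNormedType.Exports.

Local Open Scope classical_set_scope.

Definition compact_hausdorff (X : topologicalType) : Prop :=
  compact [set: X] /\ hausdorff_space X.

(* A homeomorphism onto the subspace [range f]. *)
Definition embedding (X Y : topologicalType) (f : X -> Y) : Prop :=
  [/\ continuous f, injective f &
      forall U : set X, open U ->
        exists2 V : set Y, open V & f @` U = range f `&` V].

Definition homeomorphism (X Y : topologicalType) (f : X -> Y) : Prop :=
  embedding f /\ range f = [set: Y].

Definition metrizable (R : realType) (X : topologicalType) : Prop :=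
  exists (M : metricType R) (f : X -> M), homeomorphism f.

Definition retraction (X Y : topologicalType) (f : X -> Y) : Prop :=
  continuous f /\ exists2 g : Y -> X, continuous g & cancel g f.

Section InverseLimits.
Variables (I : Type) (le : rel I) (X : I -> topologicalType).
Variable p : forall i j, le i j -> X j -> X i.

Definition threads : set (prod_topology X) :=
  [set x | forall i j (ij : le i j), p ij (x j) = x i].

Definition to_product (L : topologicalType) (q : forall i, L -> X i) :
  L -> prod_topology X := fun l i => q i l.

Definition is_inverse_limit (L : topologicalType) (q : forall i, L -> X i) :
  Prop := embedding (to_product q) /\ range (to_product q) = threads.

End InverseLimits.

(* The ordinal indexing the sequence is given by a well-ordered type. *)
Record inverse_sequence := InverseSequence {
  seq_index_disp : Order.disp_t;
  seq_index : orderType seq_index_disp;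
  seq_index_wo : well_order (<=%O : rel seq_index);
  seq_space : seq_index -> topologicalType;
  bond : forall i j : seq_index, (i <= j)%O -> seq_space j -> seq_space i;
  bond_continuous : forall (i j : seq_index) (ij : (i <= j)%O),
    continuous (bond ij);
  bond_id : forall (i : seq_index) (ii : (i <= i)%O) x, bond ii x = x;
  bond_comp : forall (i j k : seq_index)
    (ij : (i <= j)%O) (jk : (j <= k)%O) (ik : (i <= k)%O) x,
    bond ij (bond jk x) = bond ik x
}.

Definition limit_index d (I : orderType d) (a : I) : Prop :=
  (exists i, (i < a)%O) /\
  forall i, (i < a)%O -> exists2 j, (i < j)%O & (j < a)%O.

Section InverseSequences.
Variable S : inverse_sequence.

Definition below (a : seq_index S) : Type := {i : seq_index S | (i < a)%O}.

(* The restriction of [S] to the indices below [a]. *)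
Definition below_le (a : seq_index S) : rel (below a) :=
  fun i j => (sval i <= sval j)%O.
Definition below_space (a : seq_index S) (i : below a) : topologicalType :=
  seq_space (sval i).
Definition below_bond (a : seq_index S) (i j : below a) (ij : below_le i j) :
  below_space j -> below_space i := bond ij.

Definition bond_from (a : seq_index S) (i : below a) : seq_space a -> below_space i :=
  bond (ltW (svalP i)).

Definition continuous_sequence : Prop :=
  forall a : seq_index S, limit_index a ->
    is_inverse_limit (@below_bond a) (@bond_from a).

Definition retractive : Prop :=
  forall (i j : seq_index S) (ij : (i <= j)%O), retraction (bond ij).

Definition sequence_limit (L : topologicalType) (q : forall i, L -> seq_space i) :
  Prop := is_inverse_limit (@bond S) q.

End InverseSequences.

Inductive RC (R : realType) : topologicalType -> Prop :=
| RC_metrizable (K : topologicalType) :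
    compact [set: K] -> metrizable R K -> RC R K
| RC_image (K L : topologicalType) (f : K -> L) :
    RC R K -> hausdorff_space L -> continuous f -> range f = [set: L] -> RC R L
| RC_limit (S : inverse_sequence) (L : topologicalType)
    (q : forall i : seq_index S, L -> seq_space i) :
    (forall i : seq_index S, RC R (seq_space i)) ->
    continuous_sequence S -> retractive S -> sequence_limit q -> RC R L.

(* As a subspace of the product of copies of [R], this carries the topology
   induced from the cube. *)
Definition Sigma_product (R : realType) (A : Type) :
    set (prod_topology (fun _ : A => R)) :=
  [set x | (forall a, (0 <= x a <= 1)%R) /\ countable [set a | x a != 0%R]].
Arguments Sigma_product : clear implicits.

Definition Corson_compact (R : realType) (X : topologicalType) : Prop :=
  compact_hausdorff X /\
  exists (A : Type) (f : X -> prod_topology (fun _ : A => R)),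
    embedding f /\ range f `<=` Sigma_product R A.

(* This determines the ordered set [W] up to isomorphism: the elements below
   the greatest element [m] form an uncountable well-ordered set all of whose
   proper initial segments are countable, that is, a copy of omega_1. *)
Definition is_omega1_plus_1 d (W : orderType d) : Prop :=
  well_order (<=%O : rel W) /\
  exists m : W,
    [/\ forall x : W, (x <= m)%O,
        ~ countable [set x : W | (x < m)%O] &
        forall x : W, (x < m)%O -> countable [set y : W | (y < x)%O]].

Definition contains_omega1_plus_1 (X : topologicalType) : Prop :=
  exists (d : Order.disp_t) (W : orderTopologicalType d),
    is_omega1_plus_1 W /\ exists f : W -> X, embedding f.

(* Main.v *)
From HB Require Import structures.
Require Import Defs.
From mathcomp Require Import all_boot all_order all_algebra.
From mathcomp Require Import wochoice all_classical all_reals all_analysis.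
From mathcomp Require Import lra.

Set Implicit Arguments.
Unset Strict Implicit.
Unset Printing Implicit Defensive.

Import Order.TTheory GRing.Theory Num.Theory.
Import numFieldNormedType.Exports.

Local Open Scope classical_set_scope.

(* For a compact space [Y], consider families [M] of points and subsets of [Y]
   closed under suitable finitary operations, the combinatorial counterpart of
   elementary submodels.  [Y] has property [Omega] if, for almost all [M], the
   open sets in [M] separate the points of the closure of the points in [M].

   By induction on the class RC, every continuous image [f(L)] without a copy of
   omega_1 + 1 of a space [L] in RC has [Omega].  Only limits need work.
   Choosing sections of the bonding maps and propagating threads along them
   yields commuting retractions [r_i] of [L], with [f(r_i(L))] having [Omega]
   by induction, and [r_i] close to the identity on the part of [L] seen by [M]
   for large [i] in [M].  Since [f(L)] contains no copy of omega_1 + 1, every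
   value [f(x)] is attained at a point that is propagated from countably many
   indices, and elementarity reaches all such points; this transfers the
   separation from [f(r_i(L))] to [f(L)].

   Conversely [Omega] for [Y] gives, for almost all [M], a retraction of [Y]
   onto the closure of the points in [M].  Along a continuous chain of such
   [M], each point moves only countably often, so the differences of
   coordinates along the chain assemble into an embedding in a Sigma-product. *)

(** * Almost all closed families *)

Lemma countable_setU T (A B : set T) :
  countable A -> countable B -> countable (A `|` B).
Proof.
move=> cA cB; have -> : A `|` B = \bigcup_(b in [set: bool]) if b then A else B.
  apply/seteqP; split=> [t [ht|ht]|t [[] _ ht]];
    [by exists true|by exists false|by left|by right].
by apply: bigcup_countable => [|[]//].
Qed.

Lemma countable_inj T U (j : T -> U) (A : set T) (D : set U) :
  {in A &, injective j} -> (forall t, A t -> D (j t)) -> countable D ->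
  countable A.
Proof.
move=> ji jAD /countable_injP[f fi]; apply/countable_injP; exists (f \o j).
move=> s t; rewrite !inE => As At /fi; rewrite !inE => /(_ (jAD _ As) (jAD _ At)).
by apply: ji; rewrite inE.
Qed.

Definition op_closed (T : Type) (phi : seq T -> set T) (M : set T) : Prop :=
  forall s, List.Forall M s -> phi s `<=` M.

(** Almost all means all families closed under one countable-valued operation on finite sequences.
    The size of [M] is not restricted: countable families serve to bound the jumps along a chain,
    arbitrary ones are its links. *)
Definition club (T : Type) (C : set (set T)) : Prop :=
  exists2 phi : seq T -> set T, (forall s, countable (phi s)) &
    forall M, op_closed phi M -> C M.

(** The premise of [hull_op] uses [List.In], so that the induction principle gives a hypothesis for
    each entry of [s]. *)
Inductive hull (T : Type) (phi : seq T -> set T) (X : set T) : set T :=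
| hull_gen t : X t -> hull phi X t
| hull_op s t : (forall u, List.In u s -> hull phi X u) -> phi s t ->
    hull phi X t.

Lemma ForallP T (M : set T) s :
  List.Forall M s <-> forall u, List.In u s -> M u.
Proof. exact: List.Forall_forall. Qed.

Lemma hull_closed T (phi : seq T -> set T) X : op_closed phi (hull phi X).
Proof. by move=> s /ForallP sX t; exact: hull_op. Qed.

Lemma sub_hull T (phi : seq T -> set T) X : X `<=` hull phi X.
Proof. by move=> t; exact: hull_gen. Qed.

Lemma hull_min T (phi : seq T -> set T) X M :
  op_closed phi M -> X `<=` M -> hull phi X `<=` M.
Proof.
move=> cM XM t; elim=> {t} [t /XM //|s t _ IH st].
by apply: (cM s) => //; apply/ForallP.
Qed.

Lemma hull_mono T (phi : seq T -> set T) X Y :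
  X `<=` Y -> hull phi X `<=` hull phi Y.
Proof.
by move=> XY; apply: hull_min (@hull_closed _ _ _) _ => t /XY; exact: sub_hull.
Qed.

Lemma countable_lists T (D : set T) :
  countable D -> countable [set s | List.Forall D s].
Proof.
move=> /countable_injP[f fi]; apply/countable_injP.
exists (fun s => pickle (map f s)) => s1 s2; rewrite !inE /= => D1 D2.
move=> /(pcan_inj pickleK).
elim: D1 s2 D2 => [|x s Dx _ IH] [|y s'] // Ds' [fxy fss].
have [Dy Ds] : D y /\ List.Forall D s' by inversion Ds'.
by rewrite (fi _ _ _ _ fxy) ?inE// (IH s').
Qed.

(** A finite sequence from the union of an increasing chain of stages lies in one stage, so
    countably many countable stages exhaust the hull. *)
Lemma hull_countable T (phi : seq T -> set T) X :
  (forall s, countable (phi s)) -> countable X -> countable (hull phi X).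
Proof.
move=> cphi cX.
pose step (D : set T) := D `|` \bigcup_(s in [set s | List.Forall D s]) phi s.
pose stage n := iter n step X.
have stageS n : stage n `<=` stage n.+1 by move=> t; left.
have stage_mono m n : (m <= n)%N -> stage m `<=` stage n.
  move=> /subnKC <-; elim: (n - m)%N => [|k IH]; first by rewrite addn0.
  by rewrite addnS; exact: subset_trans IH (stageS _).
have cstage n : countable (stage n).
  elim: n => [//|n IH]; rewrite /stage iterS -/(stage n) /step.
  apply: countable_setU => //.
  by apply: bigcup_countable => //; exact: countable_lists.
have sub : hull phi X `<=` \bigcup_(n in [set: nat]) stage n.
  apply: hull_min => [s sM t st|t Xt]; last by exists 0%N.
  suff [n sn] : exists n, List.Forall (stage n) s.
    by exists n.+1 => //; right; exists s.
  elim: sM => {st} [|u {}s [m _ um] _ [n sn]]; first by exists 0%N; constructor.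
  exists (maxn m n); constructor; first exact: stage_mono (leq_maxl m n) _ um.
  apply/ForallP => v /(proj1 (ForallP _ _) sn); exact: stage_mono (leq_maxr m n) _.
by apply: sub_countable (subset_card_le sub) _; exact: bigcup_countable.
Qed.

Lemma club_sub T (C C' : set (set T)) : C `<=` C' -> club C -> club C'.
Proof. by move=> CC' [phi cphi phiC]; exists phi => // M /phiC/CC'. Qed.

Lemma clubT T : club [set: set T].
Proof. by exists (fun=> set0). Qed.

Lemma clubI T (C C' : set (set T)) : club C -> club C' -> club (C `&` C').
Proof.
move=> [phi cphi phiC] [psi cpsi psiC'].
exists (fun s => phi s `|` psi s) => [s|M MS].
  exact: countable_setU.
split; [apply: phiC => s /MS sub t st|apply: psiC' => s /MS sub t st].
  by apply: sub; left.
by apply: sub; right.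
Qed.

(** A diagonal intersection: the head of a sequence names the parameter [t], and the tail is fed to
    the operation for [C t]. *)
Lemma club_forall T (C : T -> set (set T)) : (forall t, club (C t)) ->
  club [set M | forall t, M t -> C t M].
Proof.
move=> cC.
have {cC}/choice[phi phiP] : forall t, exists phi : seq T -> set T,
    (forall s, countable (phi s)) /\ forall M, op_closed phi M -> C t M.
  by move=> t; have [phi ? ?] := cC t; exists phi.
exists (fun s => if s is t :: s' then phi t s' else set0) => [[|t s]|M MS t Mt].
- exact: countable0.
- exact: (phiP t).1.
- by apply: (phiP t).2 => s Ms; apply: (MS (t :: s)); constructor.
Qed.

Lemma club_const T (F : set T) : countable F -> club [set M | F `<=` M].
Proof. by move=> cF; exists (fun=> F) => // M /(_ [::]); apply; constructor. Qed.

Lemma club_exists T (P : set T) :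
  club [set M | (exists t, P t) -> exists2 t, M t & P t].
Proof.
have [[t Pt]|nP] := pselect (exists t, P t); last first.
  by apply: club_sub (clubT T) => M _ /nP.
apply: club_sub (club_const (countable1 t)) => M tM _.
by exists t => //; exact: tM.
Qed.

Lemma club_fun T (f : T -> T) : club [set M | forall t, M t -> M (f t)].
Proof.
apply: club_forall => t.
by apply: club_sub (club_const (countable1 (f t))) => M; exact.
Qed.

(** The operation is transported along [j]; as [map j] is injective, a sequence has at most one
    preimage [s0]. *)
Lemma club_preimage T0 T (j : T0 -> T) (C : set (set T0)) : injective j ->
  club C -> club [set M | C (j @^-1` M)].
Proof.
move=> ji [phi cphi phiC].
exists (fun s => \bigcup_(s0 in [set s0 | map j s0 = s]) (j @` phi s0)).
  move=> s; apply: bigcup_countable => [|s0 _].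
    apply: (@countable_inj _ _ (fun=> tt) _ [set: unit]) => // s1 s2.
    by rewrite !inE /= => <- /(inj_map ji) ->.
  exact: sub_countable (card_image_le _ _) (cphi _).
move=> M MS; apply: phiC => s Ms t st; apply: (MS (map j s)).
  by apply/ForallP => _ /List.in_map_iff[v [<- /(proj1 (ForallP _ _) Ms)]].
by exists s => //; exists t.
Qed.

(** A set closed under the traces of hulls of finite sequences is itself the trace of a closed set,
    namely of the union of those hulls. Auxiliary sorts can thus be added to the type of a family
    and removed again. *)
Lemma club_project T0 T (j : T0 -> T) (C : set (set T0)) (C' : set (set T)) :
  injective j -> (forall M, C' M -> C (j @^-1` M)) -> club C' -> club C.
Proof.
move=> ji C'C [phi cphi phiC'].
exists (fun s => j @^-1` hull phi [set u | List.In u (map j s)]).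
  move=> s; apply: (@countable_inj _ _ j _
    (hull phi [set u | List.In u (map j s)])) => //.
    by move=> u v _ _ /ji.
  apply: hull_countable => //; elim: (map j s) => [|x {}s IH] /=.
    by apply: (@sub_countable _ _ _ (@set0 T)) => //; apply: subset_card_le.
  apply: (@countable_setU _ [set u | x = u] [set u | List.In u s]) => //.
  by rewrite (_ : mkset _ = [set x]) //; apply/seteqP; split=> u /= ->.
move=> M0 M0S.
pose M := \bigcup_(s in [set s | List.Forall M0 s])
  hull phi [set u | List.In u (map j s)].
have -> : M0 = j @^-1` M.
  apply/seteqP; split=> [t M0t|t [s M0s]]; last exact: M0S.
  exists [:: t]; first by constructor.
  by apply: sub_hull; left.
apply: C'C; apply: phiC' => s Ms t st.
suff [s0 M0s0 s0s] : exists2 s0, List.Forall M0 s0 &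
    forall u, List.In u s -> hull phi [set u | List.In u (map j s0)] u.
  by exists s0 => //; exact: hull_op st.
elim: Ms {st} => [|u {}s [s1 M0s1 s1u] _ [s2 M0s2 s2s]].
  by exists [::]; [constructor|].
exists (s1 ++ s2).
  by apply/ForallP => v /List.in_app_iff[]; move: v; apply/ForallP; exact.
move=> v /= [<-|/s2s]; last first.
  apply: hull_mono => w /= ws; rewrite map_cat.
  by apply/List.in_app_iff; right.
by apply: hull_mono s1u => w /= ws; rewrite map_cat; apply/List.in_app_iff; left.
Qed.

Lemma club_exists2 T (P : T -> T -> Prop) :
  club [set M | (exists s t, P s t) -> exists s t, [/\ M s, M t & P s t]].
Proof.
have [[s [t Pst]]|nP] := pselect (exists s t, P s t); last first.
  by apply: club_sub (clubT T) => M _ /nP.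
apply: club_sub (club_const (countable_setU (countable1 s) (countable1 t))).
move=> M stM _; exists s, t; split=> //; apply: stM; [by left|by right].
Qed.

(** * Separation by the members of a family *)

Lemma compact_directed (X : topologicalType) (I : Type) (D : set I)
    (C : I -> set X) :
  compact [set: X] -> D !=set0 -> (forall i, D i -> closed (C i)) ->
  (forall i, D i -> C i !=set0) ->
  (forall i j, D i -> D j -> exists2 k, D k & C k `<=` C i `&` C j) ->
  exists x, forall i, D i -> C i x.
Proof.
move=> cX [i0 Di0] cC nC dC.
have FF : ProperFilter (filter_from D C).
  by apply: filter_from_proper => //; apply: filter_from_filter => //; exists i0.
have [x [_ xF]] := cX _ FF (@filterT _ _ _).
exists x => i Di; apply: cC => // U xU.
by apply: xF => //; exists i.
Qed.

(** Compactness as an induction principle: if [P A] failed, the sets [B] with [P (A \ B)] would form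
    a proper filter, and a cluster point of it in [A] would contradict the local hypothesis. *)
Lemma compact_ind (X : topologicalType) (A : set X) (P : set (set X)) :
  compact A -> P set0 -> (forall B B', B `<=` B' -> P B' -> P B) ->
  (forall B B', P B -> P B' -> P (B `|` B')) ->
  (forall a, A a -> exists U, [/\ open U, U a & P U]) -> P A.
Proof.
move=> cA P0 PS PU Ploc; apply: contrapT => nPA.
pose F := [set B | P (A `\` B)].
have FF : ProperFilter F.
  split; first by rewrite /F /= setD0.
  split; first by rewrite /F /= setDT.
  - by move=> B B' FB FB'; rewrite /F /= setDIr; exact: PU.
  - by move=> B B' BB'; apply: PS => x [Ax nB'x]; split=> // /BB'.
have FA : F A by rewrite /F /= setDv.
have [a [Aa aF]] := cA _ FF FA.
have [U [oU Ua PU']] := Ploc a Aa.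
have FU : F (~` U) by apply: PS PU' => x [_ /contrapT].
by have [x []] := aF _ U FU (open_nbhs_nbhs (conj oU Ua)).
Qed.

Section Separation.
Variable Y : topologicalType.
Implicit Types (W : set (set Y)) (A B C K : set Y).

(** The sets are open in the ambient space but disjoint only on [K]; images of different spaces are
    thus handled inside one [Y], without subspace types. *)
Definition separated_by W K A B : Prop := exists U V,
  [/\ W U, W V, open U /\ open V, A `<=` U /\ B `<=` V &
      forall z, K z -> U z -> V z -> False].

Definition set_lattice W : Prop :=
  [/\ W set0, W [set: Y], (forall U V, W U -> W V -> W (U `|` V)) &
      (forall U V, W U -> W V -> W (U `&` V))].

Lemma separated_by_sub W K A B A' B' : A `<=` A' -> B `<=` B' ->
  separated_by W K A' B' -> separated_by W K A B.
Proof.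
move=> AA' BB' [U [V [WU WV oUV [AU BV] UV]]]; exists U, V; split=> //.
by split; [exact: subset_trans AU|exact: subset_trans BV].
Qed.

Lemma separated_byC W K A B : separated_by W K A B -> separated_by W K B A.
Proof.
move=> [U [V [WU WV [oU oV] [AU BV] UV]]]; exists V, U; split=> // z Kz Vz Uz.
exact: UV Uz Vz.
Qed.

Lemma separated_byU W K A B C : set_lattice W ->
  separated_by W K A C -> separated_by W K B C ->
  separated_by W K (A `|` B) C.
Proof.
move=> [_ _ WU_ WI_] [U [V [WU WV [oU oV] [AU CV] UV]]].
move=> [U' [V' [WU' WV' [oU' oV'] [BU CV'] UV']]].
exists (U `|` U'), (V `&` V'); split.
- exact: WU_.
- exact: WI_.
- by split; [exact: openU|exact: openI].
- by split=> z => [[/AU|/BU]|Cz]; [left|right|split; [exact: CV|exact: CV']].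
- by move=> z Kz [Uz|Uz] [Vz V'z]; [exact: UV Uz Vz|exact: UV' Uz V'z].
Qed.

Lemma separated_by0 W K A : set_lattice W -> separated_by W K set0 A.
Proof.
move=> [W0 WT _ _]; exists set0, setT; split=> //.
  by split; [exact: open0|exact: openT].
by split=> z.
Qed.

(** Two passes of compactness, from pairs of points to a point and a closed set, then to two closed
    sets; the lattice operations keep the separating sets in [W]. *)
Lemma separated_by_closed W K A C C' : compact [set: Y] -> set_lattice W ->
  closed A -> closed C -> closed C' -> A `&` C `&` C' `<=` set0 ->
  (forall y y', A y -> A y' -> y <> y' ->
     separated_by W K [set y] [set y']) ->
  separated_by W K (A `&` C) (A `&` C').
Proof.
move=> cY lO clA clC clC' CC' sepA.
have cpt B : closed B -> compact B by move=> clB; exact: subclosed_compact clB cY _.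
have step y : A y -> C y -> separated_by W K (A `&` C') [set y].
  move=> Ay Cy.
  apply: (@compact_ind _ (A `&` C') [set B | separated_by W K B [set y]]) => /=.
  - by apply: cpt; apply: closedI.
  - exact: separated_by0.
  - by move=> B B' BB'; exact: separated_by_sub.
  - by move=> B B'; exact: separated_byU.
  - move=> y' [Ay' C'y'].
    have [U [V [WU WV [oU oV] [yU y'V] UV]]] : separated_by W K [set y'] [set y].
      by apply: sepA => // yy'; apply: (CC' y); split; [split|rewrite -yy'].
    exists U; split=> //; first exact: yU.
    by exists U, V; split=> //; split.
apply: (@compact_ind _ (A `&` C) [set B | separated_by W K B (A `&` C')]) => /=.
- by apply: cpt; exact: closedI.
- exact: separated_by0.
- by move=> B B' BB'; exact: separated_by_sub.
- by move=> B B'; exact: separated_byU.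
- move=> y [Ay Cy].
  have [U [V [WU WV [oU oV] [yU y'V] UV]]] := step y Ay Cy.
  exists V; split=> //; first exact: y'V.
  by apply: separated_byC; exists U, V; split=> //; split.
Qed.

Definition points (M : set (Y + set Y)) : set Y := inl @^-1` M.
Definition members (M : set (Y + set Y)) : set (set Y) := inr @^-1` M.

(* Closed families of points and sets play the role of elementary submodels;
   [K] has property [Omega] if almost all of them separate the closure of
   their points.  This is Bandlow's characterization of Corson compacta. *)
Definition separating K (M : set (Y + set Y)) : Prop :=
  forall y y', closure (points M `&` K) y -> closure (points M `&` K) y' ->
    y <> y' -> separated_by (members M) K [set y] [set y'].

Definition Omega K : Prop := club (separating K).

Lemma club_lattice : club [set M : set (Y + set Y) | set_lattice (members M)].
Proof.
pose F : set (Y + set Y) := [set inr set0; inr setT].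
pose u (s t : Y + set Y) : Y + set Y :=
  match s, t with inr U, inr V => inr (U `|` V) | _, _ => s end.
pose v (s t : Y + set Y) : Y + set Y :=
  match s, t with inr U, inr V => inr (U `&` V) | _, _ => s end.
have cF : countable F by exact: countable_setU.
apply: club_sub (clubI (club_const cF) (clubI
  (club_forall (fun s => club_fun (u s))) (club_forall (fun s => club_fun (v s))))).
move=> M [FM [uM vM]]; split; [by apply: FM; left|by apply: FM; right| |].
- by move=> U V MU MV; exact: (uM (inr U) MU (inr V)).
- by move=> U V MU MV; exact: (vM (inr U) MU (inr V)).
Qed.

End Separation.

Lemma separation_function (R : realType) (Y : topologicalType) (A B : set Y) :
  compact_hausdorff Y -> closed A -> closed B -> A `&` B `<=` set0 ->
  exists h : Y -> R, [/\ continuous h, (forall y, 0 <= h y <= 1)%R,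
    (forall y, A y -> h y = 0%R) & (forall y, B y -> h y = 1%R)].
Proof.
move=> [cY hY] clA clB AB.
have /(@normal_separatorP R)/(_ A B clA clB) := compact_normal hY cY.
have -> : A `&` B = set0 by apply/seteqP; split.
move=> /(_ erefl)/(@uniform_separatorP _ R)[h [ch h01 h0 h1]]; exists h; split=> //.
- by move=> y; have := h01 (h y); rewrite /= in_itv /=; apply; exists y.
- by move=> y Ay; apply: h0; exists y.
- by move=> y By; apply: h1; exists y.
Qed.

(** * Well-orders and inverse limits *)

Definition covers d (I : orderType d) (i j : I) : Prop :=
  (i < j)%O /\ forall k, (k < j)%O -> (k <= i)%O.

Lemma order_cases d (I : orderType d) (i : I) :
  [\/ forall j, (i <= j)%O, exists j, covers j i | limit_index i].
Proof.
have [|/forallNP nmin] := pselect (exists j, (j < i)%O); last first.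
  by constructor 1 => j; rewrite leNgt; apply/negP/nmin.
have [?|/existsNP[k /not_implyP[ki nk]] _] := pselect (forall k, (k < i)%O ->
    exists2 j, (k < j)%O & (j < i)%O); first by constructor 3.
constructor 2; exists k; split=> // j ji; rewrite leNgt; apply/negP => kj.
by apply: nk; exists j.
Qed.

Lemma covers_inj d (I : orderType d) (i i' j : I) :
  covers i j -> covers i' j -> i = i'.
Proof.
by move=> [ij hi] [i'j hi']; apply/eqP; rewrite eq_le hi ?hi'.
Qed.

Lemma covers_limit d (I : orderType d) (i j : I) :
  covers i j -> limit_index j -> False.
Proof.
by move=> [ij hi] [_ /(_ i ij)[k ik /hi]]; rewrite leNgt ik.
Qed.

Lemma wo_min d (I : orderType d) (P : set I) :
  well_order (<=%O : rel I) -> P !=set0 ->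
  exists2 i, P i & forall j, P j -> (i <= j)%O.
Proof.
move=> wo [i Pi].
have [|m [[]]] := wo (mem P) _; first by exists i; exact/mem_set.
move=> /set_mem Pm mmin _; exists m => // j Pj.
by apply: mmin; exact/mem_set.
Qed.

Lemma wo_ind d (I : orderType d) (P : I -> Prop) :
  well_order (<=%O : rel I) ->
  (forall i, (forall j, (j < i)%O -> P j) -> P i) -> forall i, P i.
Proof.
move=> wo IH i; apply: contrapT => nPi.
have [|m nPm mmin] := @wo_min _ _ [set i | ~ P i] wo; first by exists i.
apply: nPm; apply: IH => j jm; apply: contrapT => /mmin.
by rewrite leNgt jm.
Qed.

Lemma closed_equalizer (X Y : topologicalType) (f g : X -> Y) :
  hausdorff_space Y -> continuous f -> continuous g ->
  closed [set x | f x = g x].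
Proof.
move=> hY cf cg x clx; apply: hY => A B fA gB.
have fA' : nbhs x (f @^-1` A) := cf x A fA.
have gB' : nbhs x (g @^-1` B) := cg x B gB.
have [z [fgz [Az Bz]]] := clx _ (filterI fA' gB').
by exists (f z); split=> //; rewrite fgz.
Qed.

Lemma embedding_compact (X Y : topologicalType) (f : X -> Y) :
  embedding f -> compact (range f) -> compact [set: X].
Proof.
move=> [cf fi fo] crf F FF FT.
have Frf : F (f @^-1` range f) by apply: filterS FT => x _; exists x.
have [_ [[x _ <-] Fx]] 
  := crf (f @ F) (fmap_proper_filter f FF) Frf.
exists x; split=> // A B FA; rewrite nbhsE => -[U [oU Ux] UB].
have [V oV fUV] := fo U oU.
have [_ Vfx] : (range f `&` V) (f x) by rewrite -fUV; exists x.
have FfA : F (f @^-1` (f @` A)) by apply: filterS FA => z Az; exists z.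
have [_ [[a Aa <-] Vfa]] := Fx _ _ FfA (open_nbhs_nbhs (conj oV Vfx)).
exists a; split=> //; apply: UB.
have [u Uu /fi <- //] : (f @` U) (f a) by rewrite fUV; split=> //; exists a.
Qed.

Definition lower d (I : orderType d) (S : set I) : Prop :=
  forall i j, (i <= j)%O -> S j -> S i.

Definition seg d (I : orderType d) (i : I) : set I := [set j | (j <= i)%O].

Lemma seg_lower d (I : orderType d) (i : I) : lower (seg i).
Proof. by move=> j k jk; exact: le_trans. Qed.

Section InverseLimit.
Variables (I : Type) (le : rel I) (X : I -> topologicalType).
Variable p : forall i j, le i j -> X j -> X i.
Variables (L : topologicalType) (q : forall i, L -> X i).
Hypothesis limL : is_inverse_limit p q.

Lemma limit_proj_continuous i : continuous (q i).
Proof.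
have [[cq _ _] _] := limL.
have -> : q i = (fun x : prod_topology X => x i) \o to_product q by [].
move=> x; apply: continuous_comp; first exact: cq.
exact: (@proj_continuous {classic I}).
Qed.

Lemma limit_proj_inj l l' : (forall i, q i l = q i l') -> l = l'.
Proof.
have [[_ iq _] _] := limL.
by move=> ql; apply: iq; apply: functional_extensionality_dep.
Qed.

Lemma limit_proj_bond i j (ij : le i j) l : p ij (q j l) = q i l.
Proof.
have [_ rq] := limL.
have : threads p (to_product q l) by rewrite -rq; exists l.
exact.
Qed.

Lemma limit_lift (x : forall i, X i) :
  (forall i j (ij : le i j), p ij (x j) = x i) ->
  exists l, forall i, q i l = x i.
Proof.
have [_ rq] := limL.
move=> thx; have [l _ <-] : range (to_product q) x by rewrite rq; exact: thx.
by exists l.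
Qed.

Lemma limit_hausdorff : (forall i, hausdorff_space (X i)) -> hausdorff_space L.
Proof.
move=> hX l l' ll'; apply: limit_proj_inj => i; apply: hX => A B lA l'B.
have lA' : nbhs l (q i @^-1` A) := limit_proj_continuous lA.
have l'B' : nbhs l' (q i @^-1` B) := limit_proj_continuous l'B.
by have [z [Az Bz]] := ll' _ _ lA' l'B'; exists (q i z).
Qed.

Lemma limit_compact : (forall i, compact_hausdorff (X i)) ->
  (forall i j (ij : le i j), continuous (p ij)) -> compact_hausdorff L.
Proof.
move=> chX cp; have [eq rq] := limL.
split; last by apply: limit_hausdorff => i; have [] := chX i.
apply: (embedding_compact eq); rewrite rq.
apply: (@subclosed_compact _ _ [set: prod_topology X]) => //.
  have -> : threads p = \bigcap_(i in [set: I]) \bigcap_(j in [set: I])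
      \bigcap_(ij in [set: le i j])
      [set x : prod_topology X | p ij (x j) = x i].
    apply/seteqP; split=> [x thx i _ j _ ij _|x thx i j ij]; first exact: thx.
    exact: thx.
  apply: closed_bigI => i _; apply: closed_bigI => j _; apply: closed_bigI => ij _.
  apply: closed_equalizer; first by have [] := chX i.
    move=> x; apply: (@continuous_comp _ _ _ (fun x : prod_topology X => x j)).
      exact: (@proj_continuous {classic I}).
    exact: cp.
  exact: (@proj_continuous {classic I}).
have -> : [set: prod_topology X] = [set x | forall i, [set: X i] (x i)].
  by apply/seteqP; split.
by apply: (@tychonoff {classic I} X (fun=> setT)) => i; have [] := chX i.
Qed.

End InverseLimit.

(** * Propagated threads *)

Section RetractiveSequence.
Variables (S : inverse_sequence) (L : topologicalType)
  (q : forall i : seq_index S, L -> seq_space i).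
Hypotheses (contS : continuous_sequence S) (retrS : retractive S)
  (limL : sequence_limit q).
Hypothesis chS : forall i : seq_index S, compact_hausdorff (seq_space i).

Local Notation I := (seq_index S).
Local Notation X := (@seq_space S).

Let wo : well_order (<=%O : rel I) := @seq_index_wo S.
Let cq i : continuous (q i) := @limit_proj_continuous _ _ _ _ _ _ limL i.

Lemma sequence_limit_compact : compact_hausdorff L.
Proof. by apply: (limit_compact limL) => // i j ij; exact: bond_continuous. Qed.

Definition section i j (ij : (i <= j)%O) : X i -> X j :=
  s2val (cid2 (proj2 (retrS ij))).

Lemma section_continuous i j (ij : (i <= j)%O) : continuous (section ij).
Proof. exact: s2valP (cid2 (proj2 (retrS ij))). Qed.

Lemma sectionK i j (ij : (i <= j)%O) : cancel (section ij) (bond ij).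
Proof. exact: s2valP' (cid2 (proj2 (retrS ij))). Qed.

(* The threads which, outside of the initial segment [A], are carried along by
   the chosen sections of the bonding maps. *)
Definition propagated (A : set I) : set L := [set l |
  forall i j (ij : (i <= j)%O), covers i j -> ~ A j ->
    q j l = section ij (q i l)].

Lemma propagated_closed A : closed (propagated A).
Proof.
have -> : propagated A = \bigcap_(i in [set: I]) \bigcap_(j in [set: I])
    \bigcap_(ij in [set ij : (i <= j)%O | covers i j /\ ~ A j])
    [set l | q j l = section ij (q i l)].
  apply/seteqP; split=> [l cl i _ j _ ij [cij Aj]|l cl i j ij cij Aj].
    exact: cl.
  exact: cl.
apply: closed_bigI => i _; apply: closed_bigI => j _; apply: closed_bigI => ij _.
apply: closed_equalizer; [by have [] := chS j|exact: cq|].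
move=> x; apply: (@continuous_comp _ _ _ (q i)); first exact: cq.
exact: section_continuous.
Qed.

Lemma propagated_sub A B : A `<=` B -> propagated A `<=` propagated B.
Proof. by move=> AB l cl i j ij cij nBj; apply: cl => // /AB. Qed.

Lemma limit_bond_inj i (x y : X i) : limit_index i ->
  (forall j (ji : (j <= i)%O), (j < i)%O -> bond ji x = bond ji y) -> x = y.
Proof.
move=> li xy; apply: (limit_proj_inj (contS li)) => -[j ji].
exact: xy.
Qed.

(** Transfinite induction: outside [A] a section dictates the coordinate at a successor and
    continuity of the sequence the one at a limit, while the least index lies in [A]. *)
Lemma propagated_inj A l l' : lower A -> A !=set0 ->
  propagated A l -> propagated A l' -> (forall i, A i -> q i l = q i l') ->
  l = l'.
Proof.
move=> lA [a Aa] cl cl' ll'; apply: (limit_proj_inj limL).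
apply: (wo_ind wo) => i IH.
have [Ai|nAi] := pselect (A i); first exact: ll'.
have [imin|[j ci]|li] := order_cases i.
- by case: nAi; exact: lA (imin a) Aa.
- have ji := ltW ci.1.
  by rewrite (cl _ _ ji)// (cl' _ _ ji)// IH//; exact: ci.1.
- apply: limit_bond_inj => // j ji jlti.
  by rewrite !(limit_proj_bond limL); exact: IH.
Qed.

Section Lift.
Variables (A : set I) (u : forall i, X i).
Hypotheses (lA : lower A) (A0 : A !=set0)
  (uA : forall i j (ij : (i <= j)%O), A j -> bond ij (u j) = u i).

(** A partial propagated thread on the indices up to [k], recorded by its last coordinate [t]. *)
Let good k (t : X k) : Prop :=
  (forall i (ik : (i <= k)%O), A i -> bond ik t = u i) /\
  (forall i j (ij : (i <= j)%O) (jk : (j <= k)%O) (ik : (i <= k)%O),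
    covers i j -> ~ A j -> bond jk t = section ij (bond ik t)).

Let good_bond k m (km : (k <= m)%O) (t : X m) : good t -> good (bond km t).
Proof.
move=> [tu ts]; split=> [i ik Ai|i j ij jk ik cij nAj].
  by rewrite (bond_comp _ _ (le_trans ik km)); exact: tu.
rewrite (bond_comp _ _ (le_trans ik km)) (bond_comp _ _ (le_trans jk km)).
exact: ts.
Qed.

(** Uniqueness is carried along with existence: at a limit it makes the good points below [k]
    compatible, so that continuity of the sequence glues them. At a successor the section is
    applied. *)
Let good_ex k : exists t : X k, good t /\ forall t', good t' -> t' = t.
Proof.
move: k; apply: (wo_ind wo) => k IH.
have [Ak|nAk] := pselect (A k).
  exists (u k); split.
    split=> [i ik Ai|i j ij jk ik cij nAj]; first exact: uA.
    by case: nAj; exact: lA jk Ak.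
  by move=> t' [/(_ k (lexx k) Ak) <- _]; rewrite bond_id.
have nk i : A i -> (i <= k)%O -> (i < k)%O.
  by move=> Ai; rewrite le_eqVlt => /orP[/eqP ik|//]; rewrite ik in Ai.
have [kmin|[z cz]|lk] := order_cases k.
- by have [a Aa] := A0; case: nAk; exact: lA (kmin a) Aa.
- have [t [gt tuniq]] := IH z cz.1.
  have zk := ltW cz.1.
  exists (section zk t); split; last first.
    move=> t' gt'; rewrite -(tuniq _ (good_bond zk gt')).
    by rewrite -[LHS](bond_id (lexx k)); exact: gt'.2.
  split=> [i ik Ai|i j ij jk ik cij nAj].
    have iz : (i <= z)%O by apply: cz.2; exact: nk.
    by rewrite -(bond_comp iz zk) sectionK; exact: gt.1.
  have /orP[/eqP jk'|jk'] : (j == k) || (j < k)%O by rewrite -le_eqVlt.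
    subst j; have iz := covers_inj cij cz; subst i.
    rewrite bond_id (bool_irrelevance ij zk) (bool_irrelevance ik zk).
    by rewrite sectionK.
  have jz := cz.2 _ jk'.
  have iz := le_trans ij jz.
  rewrite -(bond_comp iz zk) -(bond_comp jz zk) !sectionK.
  exact: gt.2.
- pose v (i : below k) : below_space i := projT1 (cid (IH (sval i) (svalP i))).
  have vP (i : below k) : good (v i) /\ forall t', good t' -> t' = v i.
    exact: projT2 (cid (IH (sval i) (svalP i))).
  have [t tv] : exists t, forall i : below k, bond_from i t = v i.
    apply: (limit_lift (contS lk)) => i j ij.
    by apply: (vP i).2; exact: good_bond (vP j).1.
  have tv' i (ik : (i <= k)%O) (ik' : (i < k)%O) :
      bond ik t = v (exist _ i ik').
    by rewrite -tv /bond_from; congr (bond _ _); exact: bool_irrelevance.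
  exists t; split.
    split=> [i ik Ai|i j ij jk ik cij nAj].
      rewrite (tv' _ _ (nk _ Ai ik)) -[LHS](bond_id (lexx i)).
      exact ((vP (exist _ i _)).1.1 i (lexx i) Ai).
    have jk' : (j < k)%O.
      have /orP[/eqP jk'|//] : (j == k) || (j < k)%O by rewrite -le_eqVlt.
      by subst j; have := covers_limit cij lk.
    rewrite (tv' _ _ jk') -(bond_comp ij jk ik) (tv' _ _ jk').
    rewrite -[LHS](bond_id (lexx j)).
    exact ((vP (exist _ j jk')).1.2 i j ij (lexx j) ij cij nAj).
  move=> t' gt'; apply: limit_bond_inj => // j jk jk'.
  rewrite (tv' _ _ jk'); apply ((vP (exist _ j jk')).2 (bond jk t')).
  exact: good_bond.
Qed.

Lemma propagated_lift : exists2 l, propagated A l & forall i, A i -> q i l = u i.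
Proof.
pose t k := projT1 (cid (good_ex k)).
have tP k : good (t k) /\ forall t', good t' -> t' = t k :=
  projT2 (cid (good_ex k)).
have [l lt] : exists l, forall i, q i l = t i.
  apply: (limit_lift limL) => i j ij.
  by apply: (tP i).2; exact: good_bond (tP j).1.
exists l => [i j ij cij nAj|i Ai].
  rewrite -(limit_proj_bond limL ij) lt -[LHS](bond_id (lexx j)).
  exact: (tP j).1.2.
by rewrite lt -[LHS](bond_id (lexx i)); exact: (tP i).1.1.
Qed.

End Lift.

(** For a nonempty lower set [A] the required thread exists by [retractP] and is unique by
    [propagated_inj]; the default [x] is returned only where none exists. *)
Definition retract (A : set I) (x : L) : L :=
  xget x [set l | propagated A l /\ forall i, A i -> q i l = q i x].

Lemma retractP A x : lower A -> A !=set0 ->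
  propagated A (retract A x) /\ forall i, A i -> q i (retract A x) = q i x.
Proof.
move=> lA A0; rewrite /retract; case: xgetP => // /(_ _) nP.
have [i j ij Aj|l cl lx] := @propagated_lift A (q^~ x) lA A0.
  exact: limit_proj_bond.
by case: (nP l).
Qed.

Lemma retract_eq A x y : lower A -> A !=set0 ->
  (forall i, A i -> q i x = q i y) -> retract A x = retract A y.
Proof.
move=> lA A0 xy; have [crx rx] := retractP x lA A0.
have [cry ry] := retractP y lA A0.
by apply: (propagated_inj lA A0) => // i Ai; rewrite rx ?ry ?xy.
Qed.

Lemma seg_neq0 (i : I) : seg i !=set0.
Proof. by exists i; rewrite /seg /=. Qed.

(** The map [q i] is a bijection from the compact set of threads propagated beyond [i] onto [X i],
    so its inverse [e] is continuous. This makes the retraction continuous and exhibits its range as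
    an image of [X i]. *)
Lemma seg_extension i : exists e : X i -> L,
  [/\ continuous e, range e = propagated (seg i) &
      forall x, retract (seg i) x = e (q i x)].
Proof.
have ex (x : X i) : exists l, propagated (seg i) l /\ q i l = x.
  have [u ux] : {u : forall j, X j | forall j (ji : (j <= i)%O), bond ji x = u j}.
    suff u j : {y : X j | forall ji : (j <= i)%O, bond ji x = y}.
      by exists (fun j => sval (u j)) => j; exact: svalP (u j).
    case: (pselect (j <= i)%O) => [ji|/negP]; last rewrite -ltNge => /ltW ij.
      by exists (bond ji x) => ji'; rewrite (bool_irrelevance ji ji').
    (* Some point of [X j] has to be given for [j] above [i], and the section supplies one; the
       condition constrains it only when [j] is [i]. *)
    exists (section ij x) => ji.
    have jE : j = i by apply/eqP; rewrite eq_le ji ij.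
    subst j; rewrite bond_id -[RHS](bond_id (lexx i)).
    by rewrite (bool_irrelevance (lexx i) ij) sectionK.
  have [||j k jk ki|l cl lu] := @propagated_lift (seg i) u.
  - exact: seg_lower.
  - exact: seg_neq0.
  - by rewrite -(ux _ (le_trans jk ki)) -(ux _ ki); exact: bond_comp.
  - by exists l; split=> //; rewrite lu /seg /= -?(ux _ (lexx i)) ?bond_id.
have /choice[e eP] : forall x : X i, exists l, propagated (seg i) l /\ q i l = x.
  exact: ex.
have qinj l l' : propagated (seg i) l -> propagated (seg i) l' ->
    q i l = q i l' -> l = l'.
  move=> cl cl' ll'; apply: propagated_inj (@seg_lower _ _ i) (seg_neq0 i) cl cl' _.
  by move=> j ji; rewrite -!(limit_proj_bond limL ji) ll'.
exists e; split.
- apply/continuous_closedP => C clC.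
  have -> : e @^-1` C = q i @` (C `&` propagated (seg i)).
    apply/seteqP; split=> [x Cx|_ [l [Cl cl] <-]].
      by exists (e x); [split=> //; exact: (eP x).1|exact: (eP x).2].
    by rewrite /preimage /= (_ : e (q i l) = l)//; apply: qinj; have [] := eP (q i l).
  apply: compact_closed; first by have [] := chS i.
  apply: continuous_compact; first exact/continuous_subspaceT/cq.
  apply: (@subclosed_compact _ _ setT) => //.
    by apply: closedI => //; exact: propagated_closed.
  by have [] := sequence_limit_compact.
- apply/seteqP; split=> [_ [x _ <-]|l cl]; first exact: (eP x).1.
  by exists (q i l) => //; apply: qinj => //; have [] := eP (q i l).
- move=> x; have [cr rx] := retractP x (@seg_lower _ _ i) (seg_neq0 i).
  apply: qinj => //; first exact: (eP _).1.
  by rewrite (eP _).2 rx// /seg /=.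
Qed.

Lemma retract_seg_continuous i : continuous (retract (seg i)).
Proof.
have [e [ce _ re]] := seg_extension i.
have -> : retract (seg i) = e \o q i by apply/funext => x; rewrite re.
by move=> x; apply: continuous_comp; [exact: cq|exact: ce].
Qed.

(* On threads that are propagated beyond [A], the coordinates in [A] determine
   the uniformity; those in a cofinal [B] suffice. *)
Lemma propagated_uniform (B A : set I) (E : set (L * L)) :
  B !=set0 -> (forall i, A i -> exists2 j, B j & (i <= j)%O) -> lower A ->
  B `<=` A -> closed E -> (forall x, ~ E (x, x)) ->
  exists2 i, B i & forall x y, propagated A x -> propagated A y ->
    q i x = q i y -> ~ E (x, y).
Proof.
move=> B0 AB lA BA clE nE; apply: contrapT => nB.
pose G i := [set xy : L * L |
  [/\ propagated A xy.1, propagated A xy.2, q i xy.1 = q i xy.2 & E xy]].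
have [cL hL] := sequence_limit_compact.
have [||i Bi|i Bi|i j Bi Bj|[x y] xyG] := @compact_directed _ _ B G.
- by rewrite -setXTT; exact: compact_setX.
- exact: B0.
- have -> : G i = [set xy | propagated A xy.1] `&` [set xy | propagated A xy.2]
      `&` [set xy | q i xy.1 = q i xy.2] `&` E.
    by apply/seteqP; split=> [xy []|xy [[[]]]].
  apply: closedI => //; apply: closedI; first apply: closedI.
  + apply: preimage_closed => [z _|]; [exact: cvg_fst|exact: propagated_closed].
  + apply: preimage_closed => [z _|]; [exact: cvg_snd|exact: propagated_closed].
  + apply: closed_equalizer; first by have [] := chS i.
      by move=> z; apply: continuous_comp; [exact: cvg_fst|exact: cq].
    by move=> z; apply: continuous_comp; [exact: cvg_snd|exact: cq].
- apply: contrapT => nG; apply: nB; exists i => // x y cx cy xy Exy.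
  by apply: nG; exists (x, y).
- wlog ij : i j Bi Bj / (i <= j)%O => [W|].
    have /orP[ij|ji] := le_total i j; first exact: W.
    by rewrite setIC; exact: W.
  exists j => // -[x y] [/= cx cy xy Exy]; split=> //; split=> //=.
  by rewrite -!(limit_proj_bond limL ij) xy.
- have [i Bi] := B0; have [cx cy _ Exy] := xyG i Bi.
  suff xy : x = y by apply: (nE x); rewrite {2}xy.
  apply: (propagated_inj lA) => // [|k Ak]; first by exists i; exact: BA.
  have [j Bj kj] := AB k Ak; have [_ _ /= xy _] := xyG j Bj.
  by rewrite -!(limit_proj_bond limL kj) xy.
Qed.

(** The case in which [E] is the product of [C] and [C']. *)
Lemma propagated_approx (B A : set I) (C C' : set L) :
  B !=set0 -> (forall i, A i -> exists2 j, B j & (i <= j)%O) -> lower A ->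
  B `<=` A -> closed C -> closed C' -> C `&` C' `<=` set0 ->
  exists2 i, B i & forall x y, propagated A x -> propagated A y ->
    q i x = q i y -> C x -> C' y -> False.
Proof.
move=> B0 AB lA BA clC clC' CC'.
have [||i Bi iP] := @propagated_uniform B A
    [set xy | C xy.1 /\ C' xy.2] B0 AB lA BA.
- by apply: closedI; apply: preimage_closed => // z _; [exact: cvg_fst|exact: cvg_snd].
- by move=> x [Cx C'x]; exact: (CC' x).
by exists i => // x y px py xy Cx C'y; exact: (iP x y).
Qed.

End RetractiveSequence.

(** * The space omega_1 + 1 *)

Lemma well_order_total_order (T : eqType) (r : rel T) :
  well_order r -> total_order r.
Proof.
move=> wo.
have wo' : {in <= T, well_order r} by move=> A _; exact: wo.
have rr : reflexive r by move=> x; exact: (wo_chain_reflexive wo').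
have ra : antisymmetric r.
  by move=> x y; exact: (wo_chain_antisymmetric wo').
have rt : total r by move=> x y; exact: (wo_chainW wo').
split=> //; split=> //; split=> // y x z rxy ryz.
(* Transitivity is read off from the least of the three elements. *)
have [|m [[]]] := wo [pred t | t \in [:: x; y; z]].
  by exists x; rewrite !inE eqxx.
rewrite !inE => /or3P[]/eqP-> mmin _.
- by apply: mmin; rewrite !inE eqxx !orbT.
- have /ra -> // : r x y && r y x.
  by rewrite rxy; apply: mmin; rewrite !inE eqxx.
- have /ra <- // : r y z && r z y.
  by rewrite ryz; apply: mmin; rewrite !inE eqxx orbT.
Qed.

Section WellOrderedType.
Variables (T : choiceType) (r : rel T) (wo : well_order r).

(** The alias takes the proof as an argument, so that each well-order of [T] can carry its own order
    structure. *)
Definition wo_type (_ : well_order r) : Type := T.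
Local Notation W := (wo_type wo).

HB.instance Definition _ := Choice.on W.

Let ro := well_order_total_order wo.

Fact wo_le_refl : reflexive (r : rel W). Proof. exact: ro.1.1.1. Qed.
Fact wo_le_anti : antisymmetric (r : rel W). Proof. exact: ro.1.2. Qed.
Fact wo_le_trans : transitive (r : rel W). Proof. exact: ro.1.1.2. Qed.
Fact wo_le_total : total (r : rel W). Proof. exact: ro.2. Qed.
Fact wo_display : Order.disp_t. Proof. exact: Order.Disp tt tt. Qed.

HB.instance Definition _ := Order.Le_isPOrder.Build wo_display W
  wo_le_refl wo_le_anti wo_le_trans.
HB.instance Definition _ :=
  Order.POrder_isTotal.Build wo_display W wo_le_total.

Lemma wo_type_wo : well_order (<=%O : rel W).
Proof. exact: wo. Qed.

End WellOrderedType.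

(** [None] is put on top of a well-order of [T], so that all of [T] is enumerated strictly below one
    index. This serves both to build omega_1 and to exhaust a space by a chain. *)
Lemma wo_with_top (T : Type) (x0 : T) :
  exists d (J : orderType d) (t : J) (g : J -> T),
    well_order (<=%O : rel J) /\ forall x, exists2 j, (j < t)%O & g j = x.
Proof.
have [r wo] := well_ordering_principle {classic T}.
pose J0 : choiceType := option {classic T}.
pose r0 : rel J0 := fun a b =>
  match a, b with Some x, Some y => r x y | _, None => true | _, _ => false end.
have [[[rr rtr] ra] rt] := well_order_total_order wo.
have wo0 : well_order r0.
  apply: antisymmetric_well_order => [[x|] [y|] //|A [[x|] Ax]].
  - by move=> /ra ->.
  - have [|m [[Am mmin] _]] := wo [pred x | Some x \in A]; first by exists x.
    exists (Some m); split=> // -[y|] //= Ay.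
    exact: mmin.
  - have [[y Ay]|nA] := pselect (exists y, Some y \in A).
      have [|m [[Am mmin] _]] := wo [pred x | Some x \in A]; first by exists y.
      exists (Some m); split=> // -[z|] //= Az.
      exact: mmin.
    exists None; split=> // -[y|] // Ay.
    by exfalso; apply: nA; exists y.
exists _, (wo_type wo0), None, (fun j => if j is Some x then x else x0).
split=> [|x]; first exact: wo_type_wo.
by exists (Some x) => //; rewrite lt_neqAle; apply/andP; split.
Qed.

(** Well-order the subsets of [nat], add a top, and keep the elements up to the least [m] with
    uncountably many predecessors. *)
Lemma omega1_plus_1_exists :
  exists d (W : orderTopologicalType d), is_omega1_plus_1 W.
Proof.
have [d [J [t [g [woJ gs]]]]] := wo_with_top (set0 : set nat).
have tunc : ~ countable [set j | (j < t)%O].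
  move=> /countable_injP[h hi].
  have /choice[k kP] : forall A, exists j, (j < t)%O /\ g j = A.
    by move=> A; have [j] := gs A; exists j.
  (* Cantor's diagonal set for the injective coding of [A] by [h (k A)]. *)
  pose D : set nat := [set n | exists2 A, h (k A) = n & ~ A n].
  have DE A : h (k A) = h (k D) -> A = D.
    move=> hAD; rewrite -(kP A).2 -[RHS](kP D).2; congr g.
    by apply: hi => //; rewrite inE; [exact: (kP A).1|exact: (kP D).1].
  have [Dn|nDn] := pselect (D (h (k D))); last by apply: (nDn); exists D.
  by have [A /DE ->] := Dn.
have [m munc mmin] := @wo_min _ _ [set j : J | ~ countable [set i | (i < j)%O]]
  woJ (ex_intro _ t tunc).
pose W0 : choiceType := {j : J | (j <= m)%O}.
pose r0 : rel W0 := fun a b => (sval a <= sval b)%O.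
have wo0 : well_order r0.
  apply: antisymmetric_well_order => [x y /le_anti/val_inj //|A [x Ax]].
  have [|_ [w Aw <-] wmin] := @wo_min _ _ (sval @` [set w | w \in A]) woJ.
    by exists (sval x), x.
  by exists w; split=> // y Ay; apply: wmin; exists y.
pose W : orderTopologicalType wo_display := order_topology (wo_type wo0).
exists _, W; split; first exact: wo_type_wo.
exists (exist _ m (lexx m)); split=> [x|cm|x xm].
- exact: svalP x.
- apply: munc; move: cm => /countable_injP[h hi].
  pose h' (j : J) := if pselect (j <= m)%O is left jm then h (exist _ j jm) else 0%N.
  apply/countable_injP; exists h' => i j; rewrite !inE /h' /= => im jm.
  case: pselect => [im'|]; last by rewrite ltW.
  case: pselect => [jm'|]; last by rewrite ltW.
  have le0 (x : J) (xm : (x <= m)%O) : (x < m)%O ->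
      (exist _ x xm : W) \in [set x : W | (x < exist _ m (lexx m))%O].
    move=> lxm; rewrite inE /= lt_neqAle; apply/andP; split=> //.
    by apply: contra_ltN lxm => /eqP [->].
  by move=> /hi; rewrite !le0// => /(_ isT isT)[].
- have xm' : (sval x < m)%O.
    rewrite lt_neqAle (svalP x) andbT; apply: contraTneq xm => xm.
    have -> : x = exist _ m (lexx m) :> W by apply: val_inj.
    by rewrite ltxx.
  have cx : countable [set j | (j < sval x)%O].
    apply: contrapT => /mmin; by rewrite leNgt xm'.
  apply: (@countable_inj _ _ (fun y : W => sval y) _ _ _ _ cx).
    by move=> y z _ _ /val_inj.
  move=> y; rewrite /mkset !lt_neqAle => /andP[yx lyx].
  apply/andP; split; last exact: lyx.
  by apply: contra yx => /eqP/val_inj ->.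
Qed.

Lemma compact_embedding (X Y : topologicalType) (f : X -> Y) :
  compact [set: X] -> hausdorff_space Y -> continuous f -> injective f ->
  embedding f.
Proof.
move=> cX hY cf fi; split=> // U oU.
exists (~` (f @` (~` U))).
  apply: closed_openC; apply: compact_closed => //.
  apply: continuous_compact; first exact/continuous_subspaceT.
  by apply: (@subclosed_compact _ _ setT) => //; exact: open_closedC.
apply/seteqP; split=> [_ [x Ux <-]|_ [[x _ <-] nfx]].
  by split; [exists x|move=> [y nUy /fi yx]; apply: nUy; rewrite yx].
by exists x => //; apply: contrapT => nUx; apply: nfx; exists x.
Qed.

Section Omega1.
Context d (W : orderTopologicalType d).
Hypothesis W1 : is_omega1_plus_1 W.

(** If [w] is not the top, the open ray below the successor of [w] is contained in this set. *)
Lemma omega1_nbhs_le (w : W) : nbhs w [set u | (u <= w)%O].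
Proof.
have [wo [m [mmax _ _]]] := W1.
have [wm|/negP] := pselect (w < m)%O; last first.
  rewrite -leNgt => mw; apply: filterS filterT => u _ /=.
  exact: le_trans (mmax u) mw.
have [|v wv vmin] := @wo_min _ _ [set u : W | (w < u)%O] wo; first by exists m.
apply: filterS (open_nbhs_nbhs (conj (@lray_open _ _ v) _)); last first.
  by rewrite /= in_itv.
move=> u; rewrite /= in_itv /= leNgt => uv; apply/negP => /vmin.
by rewrite leNgt uv.
Qed.

Lemma omega1_nbhs_lt (v w : W) : (v < w)%O -> nbhs w [set u | (v < u)%O].
Proof.
move=> vw; apply: filterS (open_nbhs_nbhs (conj (@rray_open _ _ v) _)); last first.
  by rewrite /= in_itv /= vw.
by move=> u; rewrite /= in_itv /= andbT.
Qed.

(** An ultrafilter converges to the least [w] whose closed initial segment belongs to it. *)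
Lemma omega1_compact : compact [set: W].
Proof.
have [wo [m [mmax _ _]]] := W1.
rewrite compact_ultra => F FU _.
have [|w Fw wmin] := @wo_min _ _ [set u : W | F [set v | (v <= u)%O]] wo.
  by exists m; apply: filterS filterT => u _; exact: mmax.
exists w; split=> // A; rewrite itv_nbhsE => -[i [io wi] iA].
apply: filterS iA _.
have Flt v : (w < v)%O -> F [set u | (u < v)%O].
  by move=> wv; apply: filterS Fw => u /= uw; exact: le_lt_trans wv.
have Fgt v : (v < w)%O -> F [set u | (v < u)%O].
  move=> vw; have [Fv|] := in_ultra_setVsetC [set u | (u <= v)%O] FU.
    by have := wmin v Fv; rewrite leNgt vw.
  by apply: filterS => u /= /negP; rewrite -ltNge.
case: i io wi => [[[] l|[]] [[] r|[]]] //= _; rewrite in_itv /= ?andbT.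
- move=> /andP[lw wr]; apply: filterS2 (Fgt _ lw) (Flt _ wr) => u lu ur /=.
  by rewrite in_itv /= lu.
- by move=> lw; apply: filterS (Fgt _ lw) => u lu /=; rewrite in_itv /= andbT.
- by move=> wr; apply: filterS (Flt _ wr) => u ur /=; rewrite in_itv /=.
- by move=> _; apply: filterS filterT => u.
Qed.

End Omega1.

(** * The limit step *)

Definition lower_hull d (I : orderType d) (C : set I) : set I :=
  [set i | exists2 j, C j & (i <= j)%O].

Lemma lower_hull_lower d (I : orderType d) (C : set I) : lower (lower_hull C).
Proof. by move=> i j ij [k Ck jk]; exists k => //; exact: le_trans jk. Qed.

Lemma sub_lower_hull d (I : orderType d) (C : set I) : C `<=` lower_hull C.
Proof. by move=> i Ci; exists i. Qed.

Lemma lower_hull_sub d (I : orderType d) (C D : set I) :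
  C `<=` D -> lower_hull C `<=` lower_hull D.
Proof. by move=> CD i [j /CD Dj ij]; exists j. Qed.

(** Transfinite recursion; the locality of [F] allows the recursive call, padded with [set0], to be
    replaced by [D] itself. *)
Lemma wf_set_recursion d (W : orderType d) (I : Type)
    (F : (W -> Prop) -> (W -> set I) -> set I) :
  well_order (<=%O : rel W) ->
  (forall P g h, (forall v, P v -> g v = h v) -> F P g = F P h) ->
  exists D : W -> set I, forall w, D w = F [set v | (v < w)%O] D.
Proof.
move=> wo Fext.
have wf : well_founded (fun v w : W => (v < w)%O).
  by apply: (wo_ind wo) => w IH; constructor => v /IH.
pose G w (rec : forall v : W, (v < w)%O -> set I) :=
  F [set v | (v < w)%O]
    (fun v => if pselect (v < w)%O is left vw then rec v vw else set0).
exists (Fix wf (fun=> set I) G) => w.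
rewrite Fix_eq => [|v g h gh]; last first.
  apply: Fext => u /= uv; case: pselect => // uv'; exact: gh.
by apply: Fext => u /= uv; case: pselect.
Qed.

Section LimitStep.
Variables (R : realType) (S : inverse_sequence) (L : topologicalType)
  (q : forall i : seq_index S, L -> seq_space i).
Hypotheses (contS : continuous_sequence S) (retrS : retractive S)
  (limL : sequence_limit q).
Hypothesis chS : forall i : seq_index S, compact_hausdorff (seq_space i).
Variables (Y : topologicalType) (f : L -> Y).
Hypotheses (chY : compact_hausdorff Y) (cf : continuous f)
  (nY : ~ contains_omega1_plus_1 Y).

Local Notation I := (seq_index S).
Local Notation prop A := (propagated q retrS A).
Local Notation rho A := (retract q retrS A).

Definition countably_based (z : L) : Prop :=
  exists C : set I, [/\ countable C, C !=set0 & prop (lower_hull C) z].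

(* If no [z] as required existed, the points [f (retract _ x)], taken along
   a suitable sequence of length omega_1 + 1 of initial segments, would form
   a copy of [omega_1 + 1]. *)
Lemma countably_based_point (x : L) (i0 : I) :
  exists z, [/\ countably_based z, q i0 z = q i0 x & f z = f x].
Proof.
apply: contrapT => nz; apply: nY.
have [hY cL] := (chY.2, (sequence_limit_compact limL chS).1).
have hL := (sequence_limit_compact limL chS).2.
have closed_pt (X : topologicalType) (y : X) : hausdorff_space X -> closed [set y].
  by move=> hX; apply: compact_closed => //; exact: compact_set1.
(* [eta A] is a coordinate that already tells [x] from the fibre through [rho A x], when [f] differs
   there. It comes from the approximation lemma for [setT], for which every thread is propagated. *)
have [eta etaP] : exists eta : set I -> I, forall A, f (rho A x) <> f x ->
    forall l, q (eta A) l = q (eta A) x -> f l <> f (rho A x).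
  suff /choice[eta etaP] : forall A, exists i, f (rho A x) <> f x ->
      forall l, q i l = q i x -> f l <> f (rho A x) by exists eta.
  move=> A; have [fA|nfA] := pselect (f (rho A x) = f x); first by exists i0.
  have [|||||||i _ ip] := @propagated_approx _ _ _ contS retrS limL chS
      setT setT [set x] (f @^-1` [set f (rho A x)]).
  - by exists i0.
  - by move=> i _; exists i.
  - by [].
  - by [].
  - exact: closed_pt.
  - by apply: preimage_closed; [move=> ? _; exact: cf|exact: closed_pt].
  - by move=> l [-> /= fx]; apply: nfA.
  exists i => _ l lx fl; apply: (ip x l) => //.
    by move=> ? ? ? _ /(_ Logic.I).
  by move=> ? ? ? _ /(_ Logic.I).
have [d [W W1]] := omega1_plus_1_exists; have [wo [m [mmax munc mcnt]]] := W1.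
(* [D w] is generated by [i0], which preserves the coordinate of [x] at [i0], and by all [eta (D v)]
   with [v < w], which force the image for [w] to differ from that for [v]. *)
pose B (P : W -> Prop) (D : W -> set I) : set I :=
  [set i0] `|` [set eta (D v) | v in [set v | P v]].
have [|D DE] := @wf_set_recursion _ W I (fun P D => lower_hull (B P D)) wo.
  move=> P g h gh; congr lower_hull; rewrite /B; congr setU.
  by apply/seteqP; split=> [_ [v Pv <-]|_ [v Pv <-]]; exists v => //; rewrite gh.
pose Bw w := B [set v | (v < w)%O] D.
have {}DE w : D w = lower_hull (Bw w) by rewrite DE.
have lD w : lower (D w) by rewrite DE; exact: lower_hull_lower.
have Di0 w : D w i0 by rewrite DE; apply: sub_lower_hull; left.
have D0 w : D w !=set0 by exists i0.
have Deta v w : (v < w)%O -> D w (eta (D v)).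
  by move=> vw; rewrite DE; apply: sub_lower_hull; right; exists v.
have Dmono v w : (v <= w)%O -> D v `<=` D w.
  move=> vw; rewrite !DE; apply: lower_hull_sub => i [->|[u uv <-]]; first by left.
  by right; exists u => //=; exact: lt_le_trans vw.
have rP w := retractP contS retrS limL x (lD w) (D0 w).
pose h w := f (rho (D w) x).
(* Below [m] the generating set is countable, so equality would make [rho (D v) x] one of the points
   assumed not to exist. *)
have hx v : (v < m)%O -> h v <> f x.
  move=> vm fx; apply: nz; exists (rho (D v) x); split=> //; last exact: (rP v).2.
  exists (Bw v); rewrite -DE; split; [|by exists i0; left|exact: (rP v).1].
  apply: countable_setU => //; apply: sub_countable (card_image_le _ _) _.
  exact: mcnt.
have hi : injective h.
  have hlt v w : (v < w)%O -> h v <> h w.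
    move=> vw /esym; apply: etaP; first by apply: hx; exact: lt_le_trans (mmax w).
    by apply: (rP w).2; exact: Deta.
  move=> v w hvw; case: (ltgtP v w) => // [/hlt|/hlt] //.
  by rewrite hvw.
exists d, W; split=> //; exists h.
apply: compact_embedding => //; first exact: omega1_compact W1.
move=> w N /= hN.
have [U [oU Uh] UN] : exists2 U, open_nbhs (h w) U & U `<=` N by move: hN; rewrite nbhsE.
have [|||||||i Bi ip] := @propagated_approx _ _ _ contS retrS limL chS
    (Bw w) (D w) [set rho (D w) x] (f @^-1` ~` U).
- by exists i0; left.
- by rewrite DE => i [j Bj ij]; exists j.
- exact: lD.
- by rewrite DE; exact: sub_lower_hull.
- exact: closed_pt.
- by apply: preimage_closed; [move=> ? _; exact: cf|exact: open_closedC].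
- by move=> l [-> /= nU]; apply: nU.
have hU u : (u <= w)%O -> D u i -> U (h u).
  move=> uw Dui; apply: contrapT => nU; apply: (ip (rho (D w) x) (rho (D u) x)) => //.
  - exact: (rP w).1.
  - by apply: propagated_sub (Dmono _ _ uw) _ (rP u).1.
  - by rewrite (rP u).2// (rP w).2//; exact: Dmono uw _ Dui.
(* The index [i] lies in every [D u] if it is [i0], and in [D u] for all [u] above [v] if it is
   [eta (D v)]; either way for all [u <= w] near [w]. *)
case: Bi => [ii0|[v vw vi]].
  apply: filterS (omega1_nbhs_le W1 w) => u /= uw.
  by apply: UN; apply: hU => //; rewrite ii0.
apply: filterS2 (omega1_nbhs_le W1 w) (omega1_nbhs_lt vw) => u /= uw vu.
by apply: UN; apply: hU => //; rewrite -vi; exact: Deta.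
Qed.

Local Notation T := ((Y + set Y) + (I + L))%type.
Local Notation stage i := (f @` prop (seg i)).

(* The points of [Y] whose whole fibre under [f] is sent into [U]. *)
Definition saturated (i : I) (U : set Y) : set Y :=
  ~` (f @` [set x | ~ U (f (rho (seg i) x))]).

(** The instances of elementarity used for the transfer, with four sorts: points and subsets of [Y],
    indices, points of [L]. [elementary_fibre] reflects into [M] the existence of two points in one
    fibre of which, at stage [i], one is sent into [U] and the other outside [V]. *)
Record elementary (M : set T) : Prop := Elementary {
  elementary_index : exists i, M (inr (inl i));
  elementary_image : forall x, M (inr (inr x)) -> M (inl (inl (f x)));
  elementary_retract : forall i x, M (inr (inl i)) -> M (inr (inr x)) ->
    M (inr (inr (rho (seg i) x)));
  elementary_preimage : forall y, M (inl (inl y)) -> range f y ->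
    exists z, [/\ M (inr (inr z)), countably_based z & f z = y];
  elementary_based : forall x, M (inr (inr x)) -> countably_based x ->
    prop (lower_hull [set i | M (inr (inl i))]) x;
  elementary_separating : forall i, M (inr (inl i)) ->
    separating (stage i) (inl @^-1` M);
  elementary_lattice : set_lattice (members (inl @^-1` M));
  elementary_saturated : forall i U, M (inr (inl i)) -> M (inl (inr U)) ->
    M (inl (inr (saturated i U)));
  elementary_fibre : forall i U V,
    M (inr (inl i)) -> M (inl (inr U)) -> M (inl (inr V)) ->
    (exists x x', [/\ countably_based x, countably_based x', f x = f x',
       U (f (rho (seg i) x)) & ~ V (f (rho (seg i) x'))]) ->
    exists x x', [/\ M (inr (inr x)), M (inr (inr x')) &
      [/\ countably_based x, countably_based x', f x = f x',
       U (f (rho (seg i) x)) & ~ V (f (rho (seg i) x'))]]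
}.

Lemma club_elementary (i0 : I) : (forall i, Omega (stage i)) ->
  club elementary.
Proof.
move=> OK.
pose img (t : T) : T := if t is inr (inr x) then inl (inl (f x)) else t.
pose ret (s t : T) : T :=
  match s, t with
  | inr (inl i), inr (inr x) => inr (inr (rho (seg i) x)) | _, _ => t end.
pose sat (s t : T) : T :=
  match s, t with
  | inr (inl i), inl (inr U) => inl (inr (saturated i U)) | _, _ => t end.
have inl_inj : injective (inl : Y + set Y -> T) by move=> s t [].
have cpre : club [set M : set T | forall t, M t -> forall y, t = inl (inl y) ->
    range f y -> exists z, [/\ M (inr (inr z)), countably_based z & f z = y]].
  apply: club_forall => -[[y|U]|[i|x]]; try by apply: club_sub (@clubT T) => M _.
  apply: club_sub (@club_exists T [set t | exists z,
    [/\ t = inr (inr z), countably_based z & f z = y]]) => M Mex _ [<-] [x _ fx].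
  have [z [bz _ fz]] := countably_based_point x i0.
  have [|t Mt [z' [tz' bz' fz']]] := Mex.
    by exists (inr (inr z)), z; split=> //; rewrite fz.
  by exists z'; split=> //; rewrite -tz'.
have cbas : club [set M : set T | forall t, M t -> forall x, t = inr (inr x) ->
    countably_based x -> prop (lower_hull [set i | M (inr (inl i))]) x].
  apply: club_forall => -[[y|U]|[i|x]]; try by apply: club_sub (@clubT T) => M _.
  have [[C [cC C0 pC]]|nb] := pselect (countably_based x); last first.
    by apply: club_sub (@clubT T) => M _ _ [<-].
  apply: club_sub (@club_const T ((fun i => inr (inl i)) @` C) _) => [M CM _ [<-] _|].
    by apply: propagated_sub pC; apply: lower_hull_sub => i Ci; apply: CM; exists i.
  exact: sub_countable (card_image_le _ _) cC.
have csep : club [set M : set T | forall t, M t -> forall i, t = inr (inl i) ->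
    separating (stage i) (inl @^-1` M)].
  apply: club_forall => -[[y|U]|[i|x]]; try by apply: club_sub (@clubT T) => M _.
  by apply: club_sub (club_preimage inl_inj (OK i)) => M sM _ [<-].
have cfib : club [set M : set T | forall t, M t -> forall u, M u ->
    forall v, M v -> forall i U V,
    t = inr (inl i) -> u = inl (inr U) -> v = inl (inr V) ->
    (exists x x', [/\ countably_based x, countably_based x', f x = f x',
       U (f (rho (seg i) x)) & ~ V (f (rho (seg i) x'))]) ->
    exists x x', [/\ M (inr (inr x)), M (inr (inr x')) &
      [/\ countably_based x, countably_based x', f x = f x',
       U (f (rho (seg i) x)) & ~ V (f (rho (seg i) x'))]]].
  apply: club_forall => -[[y|?]|[i|?]]; try by apply: club_sub (@clubT T) => M _.
  apply: club_forall => -[[y|U]|[?|?]]; try by apply: club_sub (@clubT T) => M _.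
  apply: club_forall => -[[y|V]|[?|?]]; try by apply: club_sub (@clubT T) => M _.
  apply: club_sub (@club_exists2 T (fun s t => exists x x',
    [/\ s = inr (inr x), t = inr (inr x') &
      [/\ countably_based x, countably_based x', f x = f x',
       U (f (rho (seg i) x)) & ~ V (f (rho (seg i) x'))]])).
  move=> M Mex _ _ _ [<-] [<-] [<-] [x [x' xx']].
  have [|s [t [Ms Mt [z [z' [sz tz' zz']]]]]] := Mex.
    by exists (inr (inr x)), (inr (inr x')), x, x'.
  by exists z, z'; split=> //; [rewrite -sz|rewrite -tz'].
apply: club_sub (clubI (club_const (countable1 (inr (inl i0) : T)))
  (clubI (club_fun img) (clubI (club_forall (fun s => club_fun (ret s)))
  (clubI cpre (clubI cbas (clubI csep (clubI (club_preimage inl_inj (club_lattice Y))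
  (clubI (club_forall (fun s => club_fun (sat s))) cfib)))))))).
move=> M [Mi0 [Mimg [Mret [Mpre [Mbas [Msep [Mlat [Msat Mfib]]]]]]]]; split=> //.
- by exists i0; exact: Mi0.
- by move=> x Mx; exact: (Mimg _ Mx).
- by move=> i x Mi Mx; exact: (Mret _ Mi _ Mx).
- by move=> y My; exact: (Mpre _ My y erefl).
- by move=> x Mx; exact: (Mbas _ Mx x erefl).
- by move=> i Mi; exact: (Msep _ Mi i erefl).
- by move=> i U Mi MU; exact: (Msat _ Mi _ MU).
- by move=> i U V Mi MU MV; exact: (Mfib _ Mi _ MU _ MV).
Qed.

Lemma closure_image_sub (X Z : topologicalType) (g : X -> Z) (B : set X)
    (D : set Z) (x : X) :
  continuous g -> (forall t, B t -> D (g t)) -> closure B x -> closure D (g x).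
Proof.
move=> cg BD Bx U gU.
have gU' : nbhs x (g @^-1` U) := cg x U gU.
by have [t [Bt Ut]] := Bx _ gU'; exists (g t); split=> //; exact: BD.
Qed.

Lemma saturated_open i U : open U -> open (saturated i U).
Proof.
move=> oU; apply: closed_openC; apply: compact_closed; first exact: chY.2.
apply: continuous_compact; first exact/continuous_subspaceT.
apply: (@subclosed_compact _ _ setT) => //; last first.
  exact: (sequence_limit_compact limL chS).1.
apply: (@preimage_closed _ _ (fun x => f (rho (seg i) x)) (~` U)) => [x _|].
  apply: (@continuous_comp _ _ _ (rho (seg i))); last exact: cf.
  exact: retract_seg_continuous.
exact: open_closedC.
Qed.

(** * Transfer of separation from the stages to the limit *)

Section Elementary.
Variable M : set T.
Hypothesis eM : elementary M.

Let A := lower_hull [set i : I | M (inr (inl i))].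
Let Z := [set x | M (inr (inr x)) /\ countably_based x].
Let P := points (inl @^-1` M).

Let closure_Z x : closure Z x -> prop A x.
Proof.
move=> Zx; apply: (propagated_closed limL chS); apply: closureS Zx => z [Mz bz].
exact: elementary_based.
Qed.

Let closure_stage i x : M (inr (inl i)) -> closure Z x ->
  closure (P `&` stage i) (f (rho (seg i) x)).
Proof.
move=> Mi; apply: (@closure_image_sub _ _ (f \o rho (seg i))) => [t|t [Mt bt]].
  apply: continuous_comp; last exact: cf.
  exact: retract_seg_continuous.
split; first by apply: (elementary_image eM); exact: elementary_retract.
exists (rho (seg i) t) => //.
exact: (retractP contS retrS limL t (@seg_lower _ _ i) (seg_neq0 i)).1.
Qed.

Let rho_A i x : M (inr (inl i)) -> prop A (rho (seg i) x).
Proof.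
move=> Mi; have [+ _] := retractP contS retrS limL x (@seg_lower _ _ i) (seg_neq0 i).
by apply: propagated_sub => j ji; exists i.
Qed.

Let q_rho i x : q i (rho (seg i) x) = q i x.
Proof.
have [_] := retractP contS retrS limL x (@seg_lower _ _ i) (seg_neq0 i).
by apply; rewrite /seg /=.
Qed.

(** If some [x'] in the fibre of [f x] had its stage-[i] image outside [U], elementarity would give
    [m], [m'] in [Z] with [f m = f m'], where [h] is below 2/10 at the stage-[i] image of [m] and
    above 4/10 at that of [m']. An error below 1/10 on each side puts [h (f m)] below and [h (f m')]
    above 3/10. *)
Let saturated_mem (h : Y -> R) (i : I) (U : set Y) (x : L) :
  continuous h -> M (inr (inl i)) -> M (inl (inr U)) ->
  (forall x x', prop A x -> prop A x' -> q i x = q i x' ->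
     (h (f x) < h (f x') + 1 / 10)%R) ->
  (forall y, closure (P `&` stage i) y -> (h y <= 4 / 10)%R -> U y) ->
  closure Z x -> h (f x) = 0%R -> saturated i U (f x).
Proof.
move=> ch Mi MU hA hU Zx hx [x' nUx' fxx'].
have [U2 [V2 [MU2 MV2 [oU2 oV2] [hU2 hV2] UV2]]] :
    separated_by (members (inl @^-1` M)) (stage i)
      (closure (P `&` stage i) `&` [set y | h y <= 1 / 10]%R)
      (closure (P `&` stage i) `&` [set y | h y >= 2 / 10]%R).
  apply: separated_by_closed; first exact: chY.1.
  - exact: elementary_lattice.
  - exact: closed_closure.
  - by apply: (@preimage_closed _ _ h [set r | r <= 1 / 10]%R) => [? _|];
      [exact: ch|exact: closed_le].
  - by apply: (@preimage_closed _ _ h [set r | r >= 2 / 10]%R) => [? _|];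
      [exact: ch|exact: closed_ge].
  - by move=> y [[_ /= y1] /= y2]; lra.
  - by move=> y y'; exact: elementary_separating.
have rho_eq z t : q i z = q i t -> rho (seg i) z = rho (seg i) t.
  move=> zt; apply: retract_eq => //; [exact: seg_lower|exact: seg_neq0|].
  by move=> j ji; rewrite -!(limit_proj_bond limL ji) zt.
(* Passing to countably based points with the same coordinate at [i] changes neither the image under
   [f] nor the retract at [i]. *)
have [z [bz /rho_eq rz fz]] := countably_based_point x i.
have [z' [bz' /rho_eq rz' fz']] := countably_based_point x' i.
have [|m [m' [Mm Mm' [bm bm' fmm' U2m nUm']]]] :=
    @elementary_fibre _ eM i U2 U Mi MU2 MU.
  exists z, z'; split=> //; first by rewrite fz fz' fxx'.
    rewrite rz; apply: hU2; split; first exact: closure_stage.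
    have := hA (rho (seg i) x) x (rho_A _ Mi) (closure_Z Zx) (q_rho i x).
    by rewrite hx /= => ?; lra.
  by rewrite rz'.
have Zm : Z m by []. have Zm' : Z m' by [].
have {}Zm := subset_closure Zm; have {}Zm' := subset_closure Zm'.
have h1 : (h (f (rho (seg i) m)) < 2 / 10)%R.
  rewrite ltNge; apply/negP => h2.
  have cm := closure_stage Mi Zm.
  apply: (UV2 (f (rho (seg i) m))) => //; last by apply: hV2.
  exists (rho (seg i) m) => //.
  exact: (retractP contS retrS limL m (@seg_lower _ _ i) (seg_neq0 i)).1.
have h2 : (4 / 10 < h (f (rho (seg i) m')))%R.
  rewrite ltNge; apply/negP => h2; apply: nUm'; apply: hU => //.
  exact: closure_stage.
have h3 := hA m (rho (seg i) m) (closure_Z Zm) (rho_A _ Mi) (esym (q_rho i m)).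
have h4 := hA (rho (seg i) m') m' (rho_A _ Mi) (closure_Z Zm') (q_rho i m').
by move: h1 h2 h3 h4; rewrite -fmm' => h1 h2 h3 h4; lra.
Qed.

(** The two points lift to the closure of [Z]. With a function [h] separating them and an index [i]
    in [M] whose coordinate determines [h] after [f] up to 1/10, the levels 4/10 and 6/10 are
    separated at stage [i] by members of [M], whose saturations separate the points. *)
Lemma elementary_separating_range : separating (range f) (inl @^-1` M).
Proof.
have [i0 Mi0] := elementary_index eM.
have lift y : closure (P `&` range f) y -> exists2 x, closure Z x & f x = y.
  move=> cly; suff : closed (f @` closure Z).
    move=> /(_ y)[]; last by move=> x Zx <-; exists x.
    apply: closureS cly => {}y [My ry].
    have [z [Mz bz <-]] := elementary_preimage eM My ry.
    by exists z => //; apply: subset_closure.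
  apply: compact_closed; first exact: chY.2.
  apply: continuous_compact; first exact/continuous_subspaceT.
  apply: (@subclosed_compact _ _ setT) => //; first exact: closed_closure.
  exact: (sequence_limit_compact limL chS).1.
move=> y y' /lift[x Zx <-{y}] /lift[x' Zx' <-{y'}] fxx'.
have closed_pt (z : Y) : closed [set z].
  by apply: compact_closed; [exact: chY.2|exact: compact_set1].
have dis : [set f x] `&` [set f x'] `<=` set0 by move=> z [-> xx']; exact: fxx'.
have [h [ch h01 h0 h1]] := @separation_function R Y [set f x] [set f x'] chY
  (closed_pt _) (closed_pt _) dis.
clear fxx' dis.
have chf : continuous (h \o f).
  by move=> z; apply: continuous_comp; [exact: cf|exact: ch].
have [||||||i Mi iP] := @propagated_uniform _ _ _ contS retrS limL chS
    [set i : I | M (inr (inl i))] A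
    ((fun xy : L * L => h (f xy.1) - h (f xy.2))%R @^-1` [set r | r >= 1 / 10]%R).
- by exists i0.
- by move=> i [j Mj ij]; exists j.
- exact: lower_hull_lower.
- exact: sub_lower_hull.
- apply: (@preimage_closed _ _ (fun xy : L * L => h (f xy.1) - h (f xy.2))%R
    [set r | r >= 1 / 10]%R) => [xy _|].
    apply: cvgB.
      by apply: (@continuous_comp _ _ _ fst (h \o f)); [exact: cvg_fst|exact: chf].
    by apply: (@continuous_comp _ _ _ snd (h \o f)); [exact: cvg_snd|exact: chf].
  exact: closed_ge.
- by move=> z /=; lra.
have hA z z' : prop A z -> prop A z' -> q i z = q i z' ->
    (h (f z) < h (f z') + 1 / 10)%R.
  by move=> pz pz' /(iP z z' pz pz')/negP; rewrite /= -ltNge; lra.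
have [U [V [MU MV [oU oV] [hU hV] UV]]] :
    separated_by (members (inl @^-1` M)) (stage i)
      (closure (P `&` stage i) `&` [set y | h y <= 4 / 10]%R)
      (closure (P `&` stage i) `&` [set y | h y >= 6 / 10]%R).
  apply: separated_by_closed; first exact: chY.1.
  - exact: elementary_lattice.
  - exact: closed_closure.
  - by apply: (@preimage_closed _ _ h [set r | r <= 4 / 10]%R) => [? _|];
      [exact: ch|exact: closed_le].
  - by apply: (@preimage_closed _ _ h [set r | r >= 6 / 10]%R) => [? _|];
      [exact: ch|exact: closed_ge].
  - by move=> y [[_ /= y1] /= y2]; lra.
  - by move=> y y'; exact: elementary_separating.
exists (saturated i U), (saturated i V); split.
- exact: elementary_saturated.
- exact: elementary_saturated.
- by split; exact: saturated_open.
- split=> _ ->.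
    apply: (saturated_mem ch) => //; last exact: h0.
    by move=> y cy hy; apply: hU.
  (* The second point is treated symmetrically, with [1 - h] for [h]. *)
  apply: (@saturated_mem (fun y => 1 - h y)%R) => //.
  + by move=> z; apply: cvgB; [exact: cvg_cst|exact: ch].
  + by move=> z z' pz pz' zz'; have := hA z' z pz' pz (esym zz'); lra.
  + by move=> y cy hy; apply: hV; split=> //=; lra.
  + by rewrite h1// subrr.
- move=> _ [z _ <-] sU sV.
  apply: (UV (f (rho (seg i) z))).
  + exists (rho (seg i) z) => //.
    exact: (retractP contS retrS limL z (@seg_lower _ _ i) (seg_neq0 i)).1.
  + by apply: contrapT => nU; apply: sU; exists z.
  + by apply: contrapT => nV; apply: sV; exists z.
Qed.

End Elementary.

(** The auxiliary sorts [I] and [L] are projected away. *)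
Lemma limit_Omega (i0 : I) : (forall i, Omega (stage i)) -> Omega (range f).
Proof.
move=> OK; apply: (@club_project _ T inl _ elementary) => [s t []//||].
  exact: elementary_separating_range.
exact: club_elementary i0 OK.
Qed.

End LimitStep.

(** * Retractions onto spans *)

Lemma closure_open_disjoint (Y : topologicalType) (U V : set Y) z :
  open V -> (forall x, U x -> V x -> False) -> closure U z -> V z -> False.
Proof.
move=> oV UV Uz Vz.
by have [x [Ux Vx]] := Uz V (open_nbhs_nbhs (conj oV Vz)); exact: UV Vx.
Qed.

Lemma covers_inj_r d (I : orderType d) (i j j' : I) :
  covers i j -> covers i j' -> j = j'.
Proof.
move=> [ij hj] [ij' hj']; case: (ltgtP j j') => // [/hj'|/hj].
  by rewrite leNgt ij.
by rewrite leNgt ij'.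
Qed.

Lemma club_countable T (C : set (set T)) (X : set T) : club C -> countable X ->
  exists M, [/\ countable M, X `<=` M & C M].
Proof.
move=> [phi cphi phiC] cX; exists (hull phi X); split.
- exact: hull_countable.
- exact: sub_hull.
- exact/phiC/hull_closed.
Qed.

Section Corson.
Variables (R : realType) (Y : topologicalType).
Hypothesis chY : compact_hausdorff Y.

Local Notation T := (Y + set Y)%type.

(** The last two clauses reflect facts about arbitrary points of [Y] to points of [M], where
    separation by members of [M] applies. *)
Record good (M : set T) : Prop := Good {
  good_separating : separating setT M;
  good_lattice : set_lattice (members M);
  good_meet : forall U V, members M U -> members M V ->
    (exists y, closure U y /\ closure V y) ->
    exists2 t, points M t & closure U t /\ closure V t;
  good_outside : forall U, members M U -> (exists y, ~ closure U y) ->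
    exists2 t, points M t & ~ closure U t
}.

Lemma club_good : Omega [set: Y] -> club good.
Proof.
move=> OY.
have cmeet : club [set M : set T | forall s, M s -> forall t, M t ->
    forall U V, s = inr U -> t = inr V ->
    (exists y, closure U y /\ closure V y) ->
    exists2 y, points M y & closure U y /\ closure V y].
  apply: club_forall => -[y|U]; first by apply: club_sub (@clubT T) => M _.
  apply: club_forall => -[y|V]; first by apply: club_sub (@clubT T) => M _.
  apply: club_sub (@club_exists T [set t | exists y,
    t = inl y /\ (closure U y /\ closure V y)]) => M Mex _ _ [<-] [<-] [y UVy].
  have [|t Mt [z [tz UVz]]] := Mex; first by exists (inl y), y.
  by exists z => //; rewrite /points /preimage /= -tz.
have cout : club [set M : set T | forall s, M s -> forall U, s = inr U ->
    (exists y, ~ closure U y) -> exists2 y, points M y & ~ closure U y].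
  apply: club_forall => -[y|U]; first by apply: club_sub (@clubT T) => M _.
  apply: club_sub (@club_exists T [set t | exists y,
    t = inl y /\ ~ closure U y]) => M Mex _ [<-] [y Uy].
  have [|t Mt [z [tz Uz]]] := Mex; first by exists (inl y), y.
  by exists z => //; rewrite /points /preimage /= -tz.
apply: club_sub (clubI OY (clubI (club_lattice Y) (clubI cmeet cout))).
move=> M [sM [lM [mM oM]]]; split=> //.
  by move=> U V MU MV; exact: (mM _ MU _ MV U V).
by move=> U MU; exact: (oM _ MU).
Qed.

Definition span (M : set T) : set Y := closure (points M).

Lemma span_mono M N : M `<=` N -> span M `<=` span N.
Proof. by move=> MN; apply: closureS => y; exact: MN. Qed.

Lemma separated_span M C C' : separating setT M -> set_lattice (members M) ->
  closed C -> closed C' -> C `&` C' `<=` set0 ->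
  separated_by (members M) setT (span M `&` C) (span M `&` C').
Proof.
move=> sM lM clC clC' CC'; apply: separated_by_closed => //.
- exact: chY.1.
- exact: closed_closure.
- by move=> y [[_ Cy] C'y]; apply: (CC' y).
- by move=> y y' My My'; apply: sM; rewrite setIT.
Qed.

(** Disjoint closures come from separating [C] from the level [h >= 1/3] and [C'] from [h <= 2/3]: a
    common point of the closures could be found in [M], and it lies in one of these two levels. *)
Lemma good_separated M C C' : good M -> closed C -> closed C' ->
  C `&` C' `<=` set0 -> exists U V, [/\ members M U, members M V,
    open U /\ open V, span M `&` C `<=` U /\ span M `&` C' `<=` V &
    forall y, closure U y -> closure V y -> False].
Proof.
move=> gM clC clC' CC'.
have [h [ch h01 h0 h1]] := @separation_function R Y C C' chY clC clC' CC'.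
have cle r : closed [set y | h y <= r]%R.
  by apply: (@preimage_closed _ _ h [set s | s <= r]%R) => [? _|];
    [exact: ch|exact: closed_le].
have cge r : closed [set y | h y >= r]%R.
  by apply: (@preimage_closed _ _ h [set s | s >= r]%R) => [? _|];
    [exact: ch|exact: closed_ge].
have lM := good_lattice gM; have sM := good_separating gM.
have [|U [U' [MU MU' [oU oU'] [CU hU'] UU']]] :=
    @separated_span M C [set y | h y >= 1 / 3]%R sM lM clC (cge _).
  by move=> y [/h0 hy]; rewrite /= hy; lra.
have [|V [V' [MV MV' [oV oV'] [CV hV'] VV']]] :=
    @separated_span M C' [set y | h y <= 2 / 3]%R sM lM clC' (cle _).
  by move=> y [/h1 hy]; rewrite /= hy; lra.
exists U, V; split=> // y Uy Vy.
have [|t Mt [Ut Vt]] := good_meet gM MU MV; first by exists y.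
have st : span M t by apply: subset_closure.
have [h3|h3] := leP (1 / 3)%R (h t).
  apply: (closure_open_disjoint oU' _ Ut) => [x|]; first exact: UU'.
  by apply: hU'.
apply: (closure_open_disjoint oV' _ Vt) => [x|]; first exact: VV'.
by apply: hV'; split=> //=; lra.
Qed.

(** No open member of [M] around [z] has a closure missing [y]. For good [M] there is exactly one
    such [z], as two would be separated by members with disjoint closures. *)
Definition near_point M (y z : Y) : Prop :=
  span M z /\ forall U, members M U -> open U -> U z -> closure U y.

Definition proj_span M (y : Y) : Y := xget y (near_point M y).

(** Otherwise, by compactness, a member containing the whole span has a closure that misses [y], and
    [good_outside] gives a point of [M] outside that closure. *)
Lemma proj_spanP M y : good M -> near_point M y (proj_span M y).
Proof.
move=> gM; rewrite /proj_span; case: xgetP => // noz; exfalso.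
have [MO0 MOT MOU _] := good_lattice gM.
have [U [MU oU sU nUy]] : exists U,
    [/\ members M U, open U, span M `<=` U & ~ closure U y].
  apply: (@compact_ind _ _ [set B | exists U,
    [/\ members M U, open U, B `<=` U & ~ closure U y]]) => /=.
  - by apply: (@subclosed_compact _ _ setT) => //;
      [exact: closed_closure|exact: chY.1].
  - by exists set0; split=> //; [exact: open0|rewrite closure0].
  - move=> B B' BB' [U [MU oU BU nU]]; exists U; split=> //.
    exact: subset_trans BU.
  - move=> B B' [U [MU oU BU nU]] [V [MV oV BV nV]]; exists (U `|` V); split.
    + exact: MOU.
    + exact: openU.
    + exact: setUSS.
    + by rewrite closureU => -[].
  - move=> z Mz; have /not_andP[//|/existsNP[U]] := noz z.
    by move=> /not_implyP[MU /not_implyP[oU /not_implyP[Uz nU]]]; exists U;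
      split=> //; exists U; split.
have [|t Mt nUt] := good_outside gM MU; first by exists y.
by apply: nUt; apply: subset_closure; apply: sU; exact: subset_closure.
Qed.

Lemma separated_points M z z' : good M -> span M z -> span M z' -> z <> z' ->
  exists U V, [/\ members M U, members M V, open U /\ open V, U z /\ V z' &
    forall y, closure U y -> closure V y -> False].
Proof.
move=> gM Mz Mz' zz'.
have cpt (x : Y) : closed [set x].
  by apply: compact_closed; [exact: chY.2|exact: compact_set1].
have [|U [V [MU MV oUV [zU z'V] UV]]] :=
    @good_separated M [set z] [set z'] gM (cpt z) (cpt z').
  by move=> x [-> ]; exact: zz'.
by exists U, V; split=> //; split; [exact: zU|exact: z'V].
Qed.

Lemma proj_span_id M z : good M -> span M z -> proj_span M z = z.
Proof.
move=> gM Mz; have [Mp pz] := proj_spanP z gM.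
apply: contrapT => /(separated_points gM Mp Mz)[U [V [MU MV [oU oV] [Up Vz]]]].
by move=> /(_ z); apply; [exact: pz|exact: subset_closure].
Qed.

(** If the projection left the closure of [U], members [V] and [W] would separate the two; [y] lies
    in the closures of [V] and [U], so a point of [M] does too, and it lies in [W]. *)
Lemma proj_span_closure M U y : good M -> members M U -> closure U y ->
  closure U (proj_span M y).
Proof.
move=> gM MU Uy; have [Mp py] := proj_spanP y gM.
apply: contrapT => nUp.
have cpt (x : Y) : closed [set x].
  by apply: compact_closed; [exact: chY.2|exact: compact_set1].
have [|V [W [MV MW [oV oW] [pV UW] VW]]] := @good_separated M
    [set proj_span M y] (closure U) gM (cpt _) (@closed_closure _ _).
  by move=> x [-> ].
have [|t Mt [Vt Ut]] := good_meet gM MV MU.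
  by exists y; split=> //; apply: py => //; exact: pV.
apply: (VW t) => //; apply: subset_closure; apply: UW; split=> //.
exact: subset_closure.
Qed.

Lemma proj_span_continuous M : good M -> continuous (proj_span M).
Proof.
move=> gM; apply/continuous_closedP => C clC.
rewrite -openC openE => y /= nCy.
have [Mp py] := proj_spanP y gM.
have cpt (x : Y) : closed [set x].
  by apply: compact_closed; [exact: chY.2|exact: compact_set1].
have [|U [V [MU MV [oU oV] [pU CV] UV]]] := @good_separated M
    [set proj_span M y] C gM (cpt _) clC.
  by move=> x [-> ].
have nVy : ~ closure V y.
  by move=> Vy; apply: (UV y) => //; apply: py => //; exact: pU.
apply: (filterS _ (open_nbhs_nbhs (conj (closed_openC (@closed_closure _ V)) nVy))).
move=> x nVx Cx; apply: nVx; have [Mx px] := proj_spanP x gM.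
by apply: px => //; exact: CV.
Qed.

(** Both projections preserve membership in the closures of members of [M], so no pair of such
    members separates the two sides. *)
Lemma proj_span_comp M N y : good M -> good N -> M `<=` N ->
  proj_span M (proj_span N y) = proj_span M y.
Proof.
move=> gM gN MN; have [Mz pz] := proj_spanP (proj_span N y) gM.
have [Mp py] := proj_spanP y gM.
apply: contrapT => /(separated_points gM Mz Mp)[U [V [MU MV [oU oV] [Uz Vp]]]].
move=> /(_ (proj_span M (proj_span N y))); apply; first exact: subset_closure.
apply: proj_span_closure => //; apply: proj_span_closure => //; first exact: MN.
exact: py.
Qed.

(** A pair of members separating the projections of [y] and [y'] lies in a single [F j], where both
    have the same projection. *)
Lemma proj_span_bigcup (J : Type) (D : set J) (F : J -> set T) M y y' :
  good M -> (forall j, D j -> good (F j)) ->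
  (forall s t, M s -> M t -> exists j, [/\ D j, F j s & F j t]) ->
  (forall j, D j -> proj_span (F j) y = proj_span (F j) y') ->
  proj_span M y = proj_span M y'.
Proof.
move=> gM gF MF yy'; have [Mp py] := proj_spanP y gM.
have [Mp' py'] := proj_spanP y' gM.
apply: contrapT => /(separated_points gM Mp Mp')[U [V [MU MV [oU oV] [Up Vp]]]].
have [j [Dj FU FV]] := MF _ _ MU MV.
move=> /(_ (proj_span (F j) y)); apply.
  by apply: proj_span_closure => //; [exact: gF|exact: py].
by rewrite yy'//; apply: proj_span_closure => //; [exact: gF|exact: py'].
Qed.

(* A Corson-type family of coordinates for the image of [proj_span M]. *)
Definition coordinates (M : set T) (G : set (Y -> R)) : Prop :=
  [/\ forall g, G g -> [/\ continuous g, (forall y, 0 <= g y <= 1)%R &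
        forall y, g (proj_span M y) = g y],
      forall y, countable [set g | G g /\ g y <> 0%R] &
      forall y y', (forall g, G g -> g y = g y') ->
        proj_span M y = proj_span M y'].

(** One Urysohn function for each of the countably many pairs of members with disjoint closures,
    composed with the projection. *)
Lemma countable_coordinates M : good M -> countable M ->
  exists G, coordinates M G.
Proof.
move=> gM cM.
have /choice[h hP] : forall UV : set Y * set Y, exists h : Y -> R,
    (forall y, closure UV.1 y -> closure UV.2 y -> False) ->
    [/\ continuous h, (forall y, 0 <= h y <= 1)%R,
      (forall y, UV.1 y -> h y = 0%R) & (forall y, UV.2 y -> h y = 1%R)].
  move=> [U V] /=.
  have [UV|nUV] := pselect (forall y, closure U y -> closure V y -> False);
    last by exists (fun=> 0%R) => /nUV.
  have [|h [ch h01 h0 h1]] := @separation_function R Y (closure U) (closure V)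
    chY (@closed_closure _ _) (@closed_closure _ _).
    by move=> y [Uy Vy]; exact: (UV y).
  exists h => _; split=> // y Uy; [apply: h0|apply: h1]; exact: subset_closure.
pose P := [set UV : set Y * set Y | [/\ members M UV.1, members M UV.2 &
  forall y, closure UV.1 y -> closure UV.2 y -> False]].
have cP : countable P.
  apply: (@sub_countable _ _ _ (members M `*` members M)).
    by apply: subset_card_le => -[U V] [].
  have cmM : countable (members M).
    by apply: (@countable_inj _ _ (inr : set Y -> T) _ M) => // U V _ _ [].
  exact: countableX.
exists [set h UV \o proj_span M | UV in P]; split.
- move=> _ [UV [_ _ PUV] <-]; have [ch h01 _ _] := hP UV PUV; split=> //=.
  + move=> y; apply: continuous_comp; first exact: proj_span_continuous.
    exact: ch.
  + by move=> y; rewrite proj_span_comp.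
- move=> y; apply: (@sub_countable _ _ _ [set h UV \o proj_span M | UV in P]).
    by apply: subset_card_le => g [].
  exact: sub_countable (card_image_le _ _) cP.
- move=> y y' gyy'; have [Mp py] := proj_spanP y gM.
  have [Mp' py'] := proj_spanP y' gM.
  apply: contrapT => /(separated_points gM Mp Mp')[U [V [MU MV [oU oV] [Up Vp]]]].
  move=> UV; have PUV : P (U, V) by [].
  have [_ _ h0 h1] := hP (U, V) UV.
  have := gyy' _ (ex_intro2 _ _ (U, V) PUV erefl).
  rewrite /= h0// h1// => /eqP; rewrite eq_sym.
  by rewrite oner_eq0.
Qed.

End Corson.

(** * Chains of retractions *)

(** A difference of coordinates is split into its positive and negative parts to stay in [[0, 1]];
    the two parts determine it. *)
Lemma pos_neg_parts_inj (R : realDomainType) (c u v : R) :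
  Num.max 0%R (u - c)%R = Num.max 0%R (v - c)%R ->
  Num.max 0%R (c - u)%R = Num.max 0%R (c - v)%R -> u = v.
Proof.
case: (ltP 0%R (u - c)%R) => h1; case: (ltP 0%R (v - c)%R) => h2;
  case: (ltP 0%R (c - u)%R) => h3; case: (ltP 0%R (c - v)%R) => h4; lra.
Qed.

Section Chain.
Variables (R : realType) (Y : topologicalType).
Hypothesis chY : compact_hausdorff Y.
Hypothesis OY : Omega [set: Y].

Local Notation T := (Y + set Y)%type.

Variables (d : Order.disp_t) (J : orderType d) (F : J -> set T) (a : J).
Hypotheses (woJ : well_order (<=%O : rel J))
  (Fgood : forall j, good (F j))
  (Fmono : forall i j, (i <= j)%O -> F i `<=` F j)
  (Flim : forall j, limit_index j -> forall t, F j t ->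
    exists2 i, (i < j)%O & F i t).

Local Notation rho j := (proj_span (F j)).

Let rho_comp i j y : (i <= j)%O -> rho i (rho j y) = rho i y.
Proof. by move=> ij; apply: (proj_span_comp R) => //; exact: Fmono. Qed.

(* If [N] is a countable closed family containing [y] and the projections
   [rho k y] for the indices [k] in [N], then [rho] does not move [y] from an
   index [i] outside of [N] to its successor: both projections are [rho k y]
   for the least index [k > i] in [N]. *)
Lemma countable_jumps (y : Y) :
  countable [set i | exists j, [/\ covers i j, (j <= a)%O & rho i y <> rho j y]].
Proof.
pose TJ := (T + J)%type.
have inl_inj : injective (inl : T -> TJ) by move=> s t [].
pose pr (t : TJ) : TJ := if t is inr j then inl (inl (rho j y)) else t.
have cout : club [set N : set TJ | forall s, N s -> forall t, N t ->
    forall j U, s = inr j -> t = inl (inr U) ->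
    (exists x, points (F j) x /\ ~ U x) ->
    exists x, [/\ N (inl (inl x)), points (F j) x & ~ U x]].
  apply: club_forall => -[t|j]; first by apply: club_sub (@clubT TJ) => N _.
  apply: club_forall => -[[x|U]|k]; try by apply: club_sub (@clubT TJ) => N _.
  apply: club_sub (@club_exists TJ [set t | exists x,
    [/\ t = inl (inl x), points (F j) x & ~ U x]]) => N Nex _ _ [<-] [<-] [x [jx Ux]].
  have [|t Nt [z [tz jz Uz]]] := Nex; first by exists (inl (inl x)), x.
  by exists z; split=> //; rewrite -tz.
have clow : club [set N : set TJ | forall s, N s -> forall t, N t ->
    forall j x, s = inr j -> t = inl (inl x) -> limit_index j ->
    points (F j) x -> exists i, [/\ N (inr i), (i < j)%O & points (F i) x]].
  apply: club_forall => -[t|j]; first by apply: club_sub (@clubT TJ) => N _.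
  apply: club_forall => -[[x|U]|k]; try by apply: club_sub (@clubT TJ) => N _.
  apply: club_sub (@club_exists TJ [set t | exists i,
    [/\ t = inr i, (i < j)%O & points (F i) x]]) => N Nex _ _ [<-] [<-] lj jx.
  have [i ij ix] := Flim lj jx.
  have [|t Nt [k [tk kj kx]]] := Nex; first by exists (inr i), i.
  by exists k; split=> //; rewrite -tk.
have cpred : club [set N : set TJ | forall s, N s -> forall i j, s = inr j ->
    covers i j -> N (inr i)].
  apply: club_forall => -[t|j]; first by apply: club_sub (@clubT TJ) => N _.
  apply: club_sub (@club_exists TJ [set t | exists i,
    t = inr i /\ covers i j]) => N Nex i _ [<-] cij.
  have [|t Nt [k [tk ckj]]] := Nex; first by exists (inr i), i.
  by rewrite (covers_inj cij ckj) -tk.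
have [N [cN aN [Npr [Ngood [Nout [Nlow Npred]]]]]] :=
  club_countable (clubI (club_fun pr)
    (clubI (club_preimage inl_inj (club_good OY))
    (clubI cout (clubI clow cpred)))) (countable1 (inr a : TJ)).
have {}aN : N (inr a) by exact: aN.
apply: (@countable_inj _ _ (inr : J -> TJ) _ N) => //; first by move=> i j _ _ [].
move=> i [j [cij ja jump]]; apply: contrapT => nNi; apply: jump.
have [k [Nk ik] kmin] := @wo_min _ _ [set k | N (inr k) /\ (i < k)%O] woJ
  (ex_intro _ a (conj aN (lt_le_trans cij.1 ja))).
have jk : (j <= k)%O by rewrite leNgt; apply/negP => /cij.2; rewrite leNgt ik.
(* A predecessor of [k] would belong to [N] and, [i] being outside [N], lie strictly above [i],
   against the minimality of [k]. *)
have lk : limit_index k.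
  have [kmin'|[m cmk]|//] := order_cases k.
    by have := kmin' i; rewrite leNgt ik.
  have Nm : N (inr m) := Npred _ Nk m k erefl cmk.
  have im : (i < m)%O.
    rewrite lt_neqAle cmk.2// andbT; apply/eqP => im; apply: nNi.
    by rewrite im.
  by have := kmin m (conj Nm im); rewrite leNgt cmk.1.
pose N0 : set T := inl @^-1` N.
pose w := rho k y.
have Nw : points N0 w := Npr _ Nk.
pose C := closure (points N0 `&` points (F k)).
have [kw _] := proj_spanP chY y (Fgood k).
(* Otherwise a member of [N] contains [C] and avoids a neighbourhood of [w]. By reflection in [N] it
   contains all points of [F k], although [w] lies in their closure. *)
have Cw : C w.
  apply: contrapT => nCw.
  have cptw : closed [set w].
    by apply: compact_closed; [exact: chY.2|exact: compact_set1].
  have [|U [V [NU NV [oU oV] [CU wV] UV]]] := @separated_span Y chY N0 C [set w]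
      (good_separating Ngood) (good_lattice Ngood) (@closed_closure _ _) cptw.
    by move=> x [Cx xw]; apply: nCw; rewrite -xw.
  have FU : points (F k) `<=` U.
    move=> x kx; apply: contrapT => nUx.
    have [|z [Nz kz nUz]] := Nout _ Nk _ NU k U erefl erefl; first by exists x.
    apply: nUz; apply: CU; split; first exact: subset_closure.
    exact: subset_closure.
  apply: (closure_open_disjoint oV _ (closureS FU kw)) => [x|]; first exact: UV.
  by apply: wV; split=> //; exact: subset_closure.
(* A point of [N] in [F k] already appears at an index of [N] below [k], which is at most [i] by
   minimality. *)
have wi : span (F i) w.
  apply: closureS Cw => x [Nx kx].
  have [m [Nm mk mx]] := Nlow _ Nk _ Nx k x erefl erefl lk kx.
  apply: (Fmono _ mx); rewrite leNgt; apply/negP => im.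
  by have := kmin m (conj Nm im); rewrite leNgt mk.
have ij := ltW cij.1.
rewrite -(rho_comp y (le_trans ij jk)) -(rho_comp y jk) -/w.
rewrite !(proj_span_id R)//.
by apply: span_mono wi; exact: Fmono.
Qed.

(** The coordinates at the first link are joined by the signed parts of [g y - g (rho i y)] for each
    step from [i] to its successor [j] and each [g] in [G j]. Countably many jumps bound the support
    at [y]; separation follows by induction along the chain. *)
Lemma limit_coordinates : limit_index a ->
  (forall i, (i < a)%O -> exists G : set (Y -> R), coordinates (F i) G) ->
  exists G : set (Y -> R), coordinates (F a) G.
Proof.
move=> la exG.
have /choice[G GP] : forall i, exists G : set (Y -> R),
    (i < a)%O -> coordinates (F i) G.
  move=> i; have [/exG[G ?]|nia] := pselect (i < a)%O; first by exists G.
  by exists set0.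
have [i1 i1a] := la.1.
have [j0 _ j0min] := @wo_min _ _ [set: J] woJ (ex_intro _ a Logic.I).
have {}j0min j : (j0 <= j)%O by exact: j0min.
have j0a : (j0 < a)%O := le_lt_trans (j0min i1) i1a.
pose pos (i : J) (g : Y -> R) : Y -> R :=
  (fun=> 0%R) \max (fun y => g y - g (rho i y))%R.
pose neg (i : J) (g : Y -> R) : Y -> R :=
  (fun=> 0%R) \max (fun y => g (rho i y) - g y)%R.
pose GG : set (Y -> R) := G j0 `|` [set g' | exists i j g,
  [/\ covers i j, (j < a)%O, G j g & g' = pos i g \/ g' = neg i g]].
have crho i : continuous (rho i) by exact: (proj_span_continuous R).
exists GG; split.
- move=> g' [Gg'|[i [j [g [cij ja Gg g'E]]]]].
    have [gP _ _] := GP j0 j0a; have [cg g01 gj0] := gP _ Gg'; split=> // y.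
    by rewrite -[LHS]gj0 rho_comp ?gj0// ltW.
  have [gP _ _] := GP j ja; have [cg g01 gj] := gP _ Gg.
  have gri y : (0 <= g (rho i y) <= 1)%R := g01 _.
  have cgr : continuous (fun y => g (rho i y)).
    by move=> y; apply: continuous_comp; [exact: crho|exact: cg].
  have gra y : g (rho a y) = g y.
    by rewrite -[LHS]gj rho_comp ?gj// ltW.
  have ria y : rho i (rho a y) = rho i y.
    by apply: rho_comp; apply: ltW; exact: lt_trans cij.1 ja.
  split.
  + have c0 : continuous (fun _ : Y => 0%R : R) by move=> y; exact: cvg_cst.
    case: g'E => ->; apply: (max_fun_continuous c0) => y; apply: cvgB;
      exact: cg || exact: cgr.
  + move=> y; have := g01 y; have := gri y => /andP[? ?] /andP[? ?].
    case: g'E => ->; rewrite /pos /neg /= le_max lexx /= ge_max ler01 /=; lra.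
  + by move=> y; case: g'E => ->; rewrite /pos /neg /= gra ria.
- move=> y.
  pose Ch := [set i | exists j, [/\ covers i j, (j <= a)%O & rho i y <> rho j y]].
  pose supp j x := [set g | G j g /\ g x <> 0%R].
  have csupp j x : (j < a)%O -> countable (supp j x).
    by move=> ja; have [_ + _] := GP j ja; apply.
  pose B i j := supp j y `|` supp j (rho i y).
  have cB i j : (j < a)%O -> countable (B i j).
    by move=> ja; apply: countable_setU; exact: csupp.
  apply: (@sub_countable _ _ _ (supp j0 y `|` \bigcup_(i in Ch)
      \bigcup_(j in [set j | covers i j /\ (j < a)%O])
        ((pos i @` B i j) `|` (neg i @` B i j)))).
    apply: subset_card_le => g' [[Gg'|[i [j [g [cij ja Gg g'E]]]]] g'y]; first by left.
    right; have [gP _ _] := GP j ja; have [cg g01 gj] := gP _ Gg.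
    have Bg : B i j g.
      apply: contrapT => nBg; apply: g'y.
      have gy : g y = 0%R by apply: contrapT => gy; apply: nBg; left.
      have gr : g (rho i y) = 0%R by apply: contrapT => gr; apply: nBg; right.
      by case: g'E => ->; rewrite /pos /neg /= gy gr subrr maxxx.
    exists i.
      exists j; split=> //; first exact: ltW.
      (* Without a jump at [i] both parts vanish at [y], because [g] factors through [rho j]. *)
      move=> rij; apply: g'y.
      have gr : g (rho i y) = g y by rewrite rij gj.
      by case: g'E => ->; rewrite /pos /neg /= gr subrr maxxx.
    by exists j => //; case: g'E => ->; [left|right]; exists g.
  apply: countable_setU; first exact: csupp.
  apply: bigcup_countable => [|i _]; first exact: countable_jumps.
  apply: bigcup_countable => [|j [cij ja]].
    apply: (@countable_inj _ _ (fun=> 0%N) _ [set: nat]) => // j j'.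
    by rewrite !inE => -[cij _] [cij' _] _; exact: covers_inj_r cij cij'.
  by apply: countable_setU; apply: sub_countable (card_image_le _ _) _; exact: cB.
- move=> y y' gyy'.
  have rho_limit j : limit_index j -> (forall i, (i < j)%O -> rho i y = rho i y') ->
      rho j y = rho j y'.
    move=> lj ij; apply: (@proj_span_bigcup R Y chY J [set i | (i < j)%O] F) => //.
    move=> s t js jt; have [i lij is_] := Flim lj js; have [k lkj kt] := Flim lj jt.
    have [ik|/ltW ki] := leP i k.
      by exists k; split=> //; exact: Fmono is_.
    by exists i; split=> //; exact: Fmono kt.
  apply: (rho_limit _ la); apply: (wo_ind woJ) => j IH ja.
  have [jmin|[i cij]|lj] := order_cases j.
  + have -> : j = j0 by apply/eqP; rewrite eq_le jmin j0min.
    by have [_ _ sep] := GP j0 j0a; apply: sep => g Gg; apply: gyy'; left.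
  + have [gP _ sep] := GP j ja; apply: sep => g Gg.
    have ri : rho i y = rho i y'.
      by apply: IH; [exact: cij.1|exact: lt_trans cij.1 ja].
    have p1 : pos i g y = pos i g y'.
      by apply: gyy'; right; exists i, j, g; split=> //; left.
    have n1 : neg i g y = neg i g y'.
      by apply: gyy'; right; exists i, j, g; split=> //; right.
    move: p1 n1; rewrite /pos /neg /= ri.
    exact: pos_neg_parts_inj.
  + by apply: (rho_limit _ lj) => i ij; apply: IH => //; exact: lt_trans ij ja.
Qed.

End Chain.

(** * The class RC *)

(** Induction on [a] for all countable [D] at once: at the least index the hull is countable, at a
    successor the last generator moves into [D], and at a limit the hulls of the initial segments
    form a continuous chain. *)
Lemma hull_coordinates (R : realType) (Y : topologicalType)
    (phi : seq (Y + set Y) -> set (Y + set Y)) (D : set (Y + set Y))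
    d (J : orderType d) (g : J -> Y + set Y) (a : J) :
  compact_hausdorff Y -> Omega [set: Y] -> (forall s, countable (phi s)) ->
  (forall M, op_closed phi M -> good M) -> well_order (<=%O : rel J) ->
  countable D ->
  exists G : set (Y -> R),
    coordinates (hull phi ([set g j | j in [set j | (j < a)%O]] `|` D)) G.
Proof.
move=> chY OY cphi phiG wo; move: a D; apply: (wo_ind wo) => a IH D cD.
pose gen j := [set g i | i in [set i | (i < j)%O]] `|` D.
have hgood X : good (hull phi X) := phiG _ (@hull_closed _ _ _).
have gen_mono i j : (i <= j)%O -> gen i `<=` gen j.
  move=> ij t [[k ki <-]|Dt]; last by right.
  by left; exists k => //; exact: lt_le_trans ij.
have [amin|[b cba]|la] := order_cases a.
- apply: countable_coordinates => //; apply: hull_countable => //.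
  apply: countable_setU => //; apply: (@sub_countable _ _ _ (@set0 (Y + set Y))) => //.
  by apply: subset_card_le => _ [k /= ka _]; move: (amin k); rewrite leNgt ka.
- have -> : [set g j | j in [set j | (j < a)%O]] `|` D =
      [set g j | j in [set j | (j < b)%O]] `|` (D `|` [set g b]).
    apply/seteqP; split=> s.
      case=> [[k /= ka <-]|Ds]; last by right; left.
      have := cba.2 _ ka; rewrite le_eqVlt => /orP[/eqP ->|kb].
        by right; right.
      by left; exists k.
    case=> [[k /= kb <-]|[Ds|->]]; [|by right|].
      by left; exists k => //=; exact: lt_trans kb cba.1.
    by left; exists b => //=; exact: cba.1.
  by apply: IH; [exact: cba.1|exact: countable_setU].
- apply: (@limit_coordinates R Y chY OY _ J (fun j => hull phi (gen j)) a wo) => //.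
  + by move=> i j ij; apply: hull_mono; exact: gen_mono.
  + move=> j lj t; move: t.
    (* Continuity of the chain: a finite sequence from the union of the earlier hulls lies in one of
       them. *)
    suff : hull phi (gen j) `<=` \bigcup_(i in [set i | (i < j)%O]) hull phi (gen i).
      by move=> sub t /sub[i ij it]; exists i.
    apply: hull_min => [s sU t st|t gt].
    * have [i ij is_] : exists2 i, (i < j)%O & List.Forall (hull phi (gen i)) s.
        elim: sU {st} => [|u {}s [i ij iu] _ [k kj ks]].
          by have [i ij] := lj.1; exists i => //; constructor.
        have [ik|/ltW ki] := leP i k.
          by exists k => //; constructor=> //; apply: hull_mono iu; exact: gen_mono.
        exists i => //; constructor=> //; apply/ForallP => v /(proj1 (ForallP _ _) ks).
        by apply: hull_mono; exact: gen_mono.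
      by exists i => //; exact: (hull_closed is_ st).
    * case: gt => [[k kj <-]|Dt].
        have [i ki ij] := lj.2 k kj; exists i => //.
        by apply: sub_hull; left; exists k.
      by have [i ij] := lj.1; exists i => //; apply: sub_hull; right.
  + by move=> i ia; exact: IH.
Qed.

Lemma product_continuous (A : Type) (X : topologicalType)
    (K : A -> topologicalType) (f : X -> prod_topology K) :
  (forall i, continuous (fun x => f x i)) -> continuous f.
Proof.
move=> cf x; apply/cvg_sup => i U [B [[V oV <-] Vx] BU].
by apply: filterS BU _; apply: (cf i x); exact: open_nbhs_nbhs.
Qed.

(** The chain ends with a hull that is all of [Y + set Y]; there the projection is the identity, so
    the coordinates separate the points of [Y]. *)
Lemma Omega_Corson (R : realType) (Y : topologicalType) :
  compact_hausdorff Y -> Omega [set: Y] -> Corson_compact R Y.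
Proof.
move=> chY OY; split=> //.
have [phi cphi phiG] := club_good OY.
have [d [J [t [g [wo gs]]]]] := wo_with_top (inr set0 : Y + set Y).
have [G] := @hull_coordinates R Y phi set0 d J g t chY OY cphi phiG wo (countable0 _).
set M := hull phi _ => -[GP Gc Gsep].
have MT s : M s.
  by have [j jt <-] := gs s; apply: sub_hull; left; exists j.
have gM : good M := phiG _ (@hull_closed _ _ _).
have rhoE y : proj_span M y = y.
  by apply: (proj_span_id R) => //; apply: subset_closure; exact: MT.
(* All functions serve as indices, with value 0 off [G], which leaves the supports countable. *)
pose f (y : Y) : prod_topology (fun _ : Y -> R => R) :=
  fun h => if pselect (G h) is left _ then h y else 0%R.
exists (Y -> R), f; split.
  apply: compact_embedding.
  - exact: chY.1.
  - by apply: (@hausdorff_product {classic (Y -> R)}) => h; exact: Rhausdorff.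
  - apply: product_continuous => h; rewrite /f.
    case: pselect => [Gh|_]; first by have [] := GP h Gh.
    by move=> y; exact: cvg_cst.
  - move=> y y' fyy'; rewrite -(rhoE y) -(rhoE y'); apply: Gsep => h Gh.
    by have := congr1 (fun x => x h) fyy'; rewrite /f; case: pselect.
move=> _ [y _ <-]; split=> [h|].
  rewrite /f; case: pselect => [Gh|_]; last by rewrite lexx ler01.
  by have [_ + _] := GP h Gh; apply.
apply: (@sub_countable _ _ _ [set h | G h /\ h y <> 0%R]); last exact: Gc.
by apply: subset_card_le => h; rewrite /= /f; case: pselect => [Gh /eqP|_ /eqP].
Qed.

(** * Property [Omega] throughout the class *)

(** A countable set lattice in [K] containing a base separates the closed fibres of [f]. The
    saturations of its members separate in [Y] and, being countably many, lie in almost every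
    family. *)
Lemma metrizable_Omega (R : realType) (K Y : topologicalType) (f : K -> Y) :
  compact [set: K] -> metrizable R K -> compact_hausdorff Y -> continuous f ->
  Omega (range f).
Proof.
move=> cK [M [h [[ch hi _] hT]]] chY cf.
have [[x0 _]|/forallNP noK] := pselect (exists x : K, True); last first.
  have -> : range f = set0 by apply/seteqP; split=> [z [x]|//]; case: (noK x).
  apply: club_sub (@clubT _) => N _ y y'.
  by rewrite setI0 closure0.
(* The countable base is taken in a pointed type, with [h x0] as its point; hence the separate
   treatment of empty [K]. *)
pose MP : pseudoPMetricType R := HB.pack_for (pseudoPMetricType R) M
  (isPointed.Build M (h x0)).
have cM : compact [set: M].
  by rewrite -hT; apply: continuous_compact => //; exact/continuous_subspaceT.
have [B cB [oB BP]] := @compact_second_countable R MP cM.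
pose X : set (K + set K) := [set inr (h @^-1` V) | V in B].
have cX : countable X by exact: sub_countable (card_image_le _ _) cB.
have [N [cN XN lN]] := club_countable (club_lattice K) cX.
have sepN x x' : x <> x' -> separated_by (members N) setT [set x] [set x'].
  move=> xx'; have hM : hausdorff_space M by exact: metric_hausdorff.
  move: hM; rewrite open_hausdorff => /(_ (h x) (h x'))[].
    by apply/eqP => /hi.
  move=> [V V'] /=; rewrite !inE => -[Vx V'x'] [oV oV' VV'].
  have [U [BU Ux] UV] := BP (h x) V (open_nbhs_nbhs (conj oV Vx)).
  have [U' [BU' Ux'] UV'] := BP (h x') V' (open_nbhs_nbhs (conj oV' V'x')).
  exists (h @^-1` U), (h @^-1` U'); split.
  - by apply: XN; exists U.
  - by apply: XN; exists U'.
  - by split; apply: open_comp => [? _|]; [exact: ch|exact: oB|exact: ch|exact: oB].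
  - by split=> _ ->.
  - move=> z _ /UV Vz /UV' V'z.
    by have : (V `&` V') (h z) by []; rewrite VV'.
pose sat (U : set K) : set Y := ~` (f @` (~` U)).
have clK (C : set K) : closed C -> closed (f @` C).
  move=> clC; apply: compact_closed; first exact: chY.2.
  apply: continuous_compact; first exact/continuous_subspaceT.
  exact: subclosed_compact clC cK _.
have cpt (y : Y) : closed [set y].
  by apply: compact_closed; [exact: chY.2|exact: compact_set1].
have clr : closed (range f) by apply: clK; exact: closedT.
pose F : set (Y + set Y) := [set inr (sat U) | U in members N].
have cF : countable F.
  apply: sub_countable (card_image_le _ _) _.
  by apply: (@countable_inj _ _ (inr : set K -> K + set K) _ N) => // U V _ _ [].
apply: club_sub (club_const cF) => Q FQ y y' _ _ yy'.
have fib z : closed (f @^-1` [set z]).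
  by apply: preimage_closed => // ? _; exact: cf.
have [|U [U' [NU NU' [oU oU'] [yU y'U'] UU']]] := @separated_by_closed K (members N)
    setT setT (f @^-1` [set y]) (f @^-1` [set y']) cK lN closedT (fib y) (fib y') _
    (fun x x' _ _ => @sepN x x').
  by move=> x [[_ /= xy] /= xy']; apply: yy'; rewrite -xy.
exists (sat U), (sat U'); split.
- by apply: FQ; exists U.
- by apply: FQ; exists U'.
- by split; apply: closed_openC; apply: clK; exact: open_closedC.
- by split=> _ -> [x nUx fx]; apply: nUx; [exact: yU|exact: y'U'].
- move=> _ [x _ <-] sx s'x; apply: (UU' x) => //.
    by apply: contrapT => nUx; apply: sx; exists x.
  by apply: contrapT => nUx; apply: s'x; exists x.
Qed.

Lemma RC_compact_hausdorff (R : realType) (X : topologicalType) :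
  RC R X -> compact_hausdorff X.
Proof.
elim=> {X} [K cK [M [h [[ch hi _] _]]]|K L f _ [cK _] hL cf fT|
    S L q _ chS contS retrS limL].
- split=> // x y xy; apply: hi; apply: metric_hausdorff => A B hA hB.
  have hA' : nbhs x (h @^-1` A) := ch x A hA.
  have hB' : nbhs y (h @^-1` B) := ch y B hB.
  by have [z [Az Bz]] := xy _ _ hA' hB'; exists (h z).
- split=> //; rewrite -fT; apply: continuous_compact => //.
  exact/continuous_subspaceT.
- exact: sequence_limit_compact limL chS.
Qed.

(** Quantifying over all maps into all such [Y] reduces closure under images to composition, and
    lets the hypothesis for each [X i] apply to the image of its copy in [L]. *)
Lemma RC_Omega (R : realType) (X : topologicalType) : RC R X ->
  forall (Y : topologicalType) (f : X -> Y), compact_hausdorff Y ->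
    ~ contains_omega1_plus_1 Y -> continuous f -> Omega (range f).
Proof.
elim=> {X} [K cK mK|K L f _ IH hL cf fT|S L q RS IH contS retrS limL] Y g chY nY cg.
- exact: (metrizable_Omega cK mK).
- have -> : range g = range (g \o f).
    apply/seteqP; split=> [_ [x _ <-]|_ [x _ <-]]; last by exists (f x).
    have [z _ <-] : range f x by rewrite fT.
    by exists z.
  by apply: IH => // x; apply: continuous_comp; [exact: cf|exact: cg].
- have chS i : compact_hausdorff (seq_space i) := RC_compact_hausdorff (RS i).
  have [[i0 _]|/forallNP noI] := pselect (exists i : seq_index S, True).
    apply: (limit_Omega R contS (retrS := retrS) limL chS) => // i.
    have [e [ce re _]] := seg_extension contS retrS limL chS i.
    rewrite -re (_ : g @` range e = range (g \o e)).
      by apply: IH => // x; apply: continuous_comp; [exact: ce|exact: cg].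
    by apply/seteqP; split=> [_ [_ [x _ <-] <-]|_ [x _ <-]]; [exists x|exists (e x)].
  (* With an empty index set, [L] has at most one point. *)
  have gE x x' : g x = g x'.
    by congr g; apply: (limit_proj_inj limL) => i; case: (noI i).
  apply: club_sub (@clubT _) => M _ y y' My My' yy'; exfalso; apply: yy'.
  have clr : closed (range g).
    apply: compact_closed; first exact: chY.2.
    apply: continuous_compact; first exact/continuous_subspaceT.
    by have [] := sequence_limit_compact limL chS.
  have [x _ <-] : range g y by apply: clr; apply: closureS My => z [].
  by have [x' _ <-] : range g y' by apply: clr; apply: closureS My' => z [].
Qed.

Theorem theorem4p3 (R : realType) (X : topologicalType) :
  RC R X -> Corson_compact R X \/ contains_omega1_plus_1 X.
Proof.
move=> RCX; have [|nX] := pselect (contains_omega1_plus_1 X); first by right.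
left; have chX := RC_compact_hausdorff RCX; apply: Omega_Corson => //.
have <- : range (@id X) = [set: X] by apply/seteqP; split=> // x _; exists x.
by apply: (RC_Omega RCX) => // x; exact: cvg_id.
Qed.
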